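(* Let $n\ge 1$, let $V\cong\mathbb{R}^{2n}$, let $P\subseteq V$ be an $n$-dimensional subspace, and let $\omega_1,\omega_2\in\bigwedge^n(V^* )$ be linearly independent $n$-forms with $\ker\omega_1=P$. Define $$\mathcal{M}=\{\mathrm{span}\{u_1,\dots,u_n\}\in Gr_n(V):\ \omega_1(u_1,\dots,u_n)\neq 0\ \text{ or }\ \omega_2(u_1,\dots,u_n)\neq 0\},$$ $$\phi\colon\mathcal{M}\to\mathbb{R}P^1,\qquad \phi(\mathrm{span}\{u_1,\dots,u_n\})=[\omega_1(u_1,\dots,u_n):\omega_2(u_1,\dots,u_n)].$$ Fix an orientation of $\mathbb{R}P^1$, let $\mu\in H^1(\mathbb{R}P^1;\mathbb{Z})\cong\mathbb{Z}$ be the corresponding generator, and set $\alpha=\phi^*(\mu)\in H^1(\mathcal{M};\mathbb{Z})$. Then $(\mathcal{M},P,\alpha)$ is a rank $n$ Maslov--Arnold space. Moreover, for every continuous loop $\gamma\colon S^1\to\mathcal{M}$, its generalized Maslov index $\langle\alpha,[\gamma]\rangle$ equals the winding number (degree) of $\phi\circ\gamma\colon S^1\to\mathbb{R}P^1$.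
   Context: $Gr_n(V)$ is the Grassmannian of $n$-dimensional subspaces of $V\cong\mathbb{R}^{2n}$. For $\omega\in\bigwedge^n(V^* )$ (a skew-symmetric $n$-linear map $V^n\to\mathbb{R}$), $\ker\omega=\{v\in V:\omega(v,w_1,\dots,w_{n-1})=0\ \forall w_i\in V\}$. For $P\in Gr_n(V)$ the train of $P$ is $\mathcal{Z}_P=\{W\in Gr_n(V):W\cap P\ne\{0\}\}$, and $\mathcal{Z}_P^1=\{W:\dim(W\cap P)=1\}$, a smooth hypersurface in $Gr_n(V)$ with normal line bundle $\nu$. A loop $\gamma\colon S^1\to Gr_n(V)$ is sufficiently generic if it is $C^\infty$, $\gamma(S^1)\cap\mathcal{Z}_P\subseteq\mathcal{Z}_P^1$, and whenever $\gamma(t)\in\mathcal{Z}_P^1$ the velocity $\dot\gamma(t)$ is not tangent to $\mathcal{Z}_P^1$. For $\mathcal{M}\subseteq Gr_n(V)$, a co-orientation of $\mathcal{Z}_P^1\cap\mathcal{M}$ is an orientation of the line bundle $\nu|_{\mathcal{Z}_P^1\cap\mathcal{M}}$. Given a co-orientation and a sufficiently generic loop $\gamma\colon S^1\to\mathcal{M}$, the geometric intersection number of $\gamma$ with the train is $\sum_{t\in S^1,\ \gamma(t)\in\mathcal{Z}_P}\mathrm{sgn}(t)$, where $\mathrm{sgn}(t)=\pm1$ according to whether the induced isomorphism $T_tS^1\to\nu_{\gamma(t)}$ preserves or reverses orientation. A rank $n$ Maslov--Arnold space $(\mathcal{M},P,\alpha)$ consists of a subset $\mathcal{M}\subseteq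 Gr_n(\mathbb{R}^{2n})$, a subspace $P\in Gr_n(\mathbb{R}^{2n})$, and a class $\alpha\in H^1(\mathcal{M};\mathbb{Z})$ of infinite order, such that $\mathcal{Z}_P^1\cap\mathcal{M}$ has a co-orientation for which the geometric intersection number with $\mathcal{Z}_P$ of every sufficiently generic loop $\gamma\colon S^1\to\mathcal{M}$ equals $\langle\alpha,[\gamma]\rangle$. *)

(* Defs.v *)
From HB Require Import structures.
From mathcomp Require Import all_boot all_order all_algebra perm.
From mathcomp Require Import all_classical all_reals all_analysis.

Set Implicit Arguments.
Unset Strict Implicit.
Unset Printing Implicit Defensive.
Import Order.TTheory GRing.Theory Num.Theory numFieldNormedType.Exports.

Local Open Scope classical_set_scope.
Local Open Scope ring_scope.

Definition simplex (R : realType) (k : nat) : set 'rV[R]_k.+1 :=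
  [set x | (forall i, 0 <= x 0 i) /\ \sum_i x 0 i = 1].

Definition face_mx (R : realType) (k : nat) (i : 'I_k.+2) (x : 'rV[R]_k.+1) :
    'rV[R]_k.+2 :=
  \row_j oapp (x 0) 0 (unlift i j).

Lemma face_subproof (R : realType) (k : nat) (i : 'I_k.+2)
  (x : set_type (@simplex R k)) : face_mx i (val x) \in @simplex R k.+1.
Proof.
have [/= x0 x1] := set_valP x; rewrite inE; split=> [j|].
  by rewrite mxE; case: (unlift i j) => [j'|]; rewrite /= ?x0.
rewrite (bigD1_ord i) //= mxE unlift_none add0r -x1.
by apply: eq_bigr => j _; rewrite mxE liftK.
Qed.

Definition face (R : realType) (k : nat) (i : 'I_k.+2)
    (x : set_type (@simplex R k)) : set_type (@simplex R k.+1) :=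
  exist _ (face_mx i (val x)) (face_subproof i x).

Lemma mx_continuous (T : topologicalType) (R : realType) (p q : nat)
  (f : T -> 'M[R]_(p, q)) :
  (forall i j, continuous (fun x => f x i j)) -> continuous f.
Proof.
move=> cf x A [B nB sBA].
have : \forall y \near x, forall i j, B i j (f y i j).
  by apply: filter_forall => i; apply: filter_forall => j; apply: cf (nB i j).
by apply: filterS => y; apply: sBA.
Qed.

Lemma face_continuous (R : realType) (k : nat) (i : 'I_k.+2) :
  continuous (@face R k i).
Proof.
apply: (@continuous_comp_initial _ _ _ set_val); apply: mx_continuous => a j x.
rewrite /= /face_mx; under eq_fun do rewrite mxE.
case: (unlift i j) => [j'|]; last by move=> B; exact: (@cst_continuous _ _ (0 : R)).  
apply: (@continuous_comp _ _ _ (fun y : set_type (@simplex R k) => val y)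
  (fun v : 'rV[R]_k.+1 => v 0 j')); last exact: coord_continuous.
exact: (@initial_continuous _ _ set_val).
Qed.

HB.instance Definition _ (R : realType) (k : nat) (i : 'I_k.+2) :=
  isContinuous.Build _ _ (@face R k i) (@face_continuous R k i).

Notation singular R k X := (continuousType (set_type (@simplex R k)) X).

Definition cochain (R : realType) (X : topologicalType) (k : nat) :=
  singular R k X -> int.

HB.instance Definition _ (R : realType) (X : topologicalType) (k : nat) :=
  GRing.Zmodule.on (cochain R X k).
HB.instance Definition _ (R : realType) (X : topologicalType) (k : nat) :=
  Choice.on (cochain R X k).

Definition coboundary (R : realType) (X : topologicalType) (k : nat)
    (c : cochain R X k) : cochain R X k.+1 :=
  fun s => \sum_(i < k.+2) (-1) ^+ i * c (s \o face i : continuousType _ _).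

Lemma coboundaryB (R : realType) (X : topologicalType) (k : nat) :
  {morph @coboundary R X k : a b / a - b}.
Proof.
move=> a b; apply/funext => s; 
rewrite -[RHS]/(coboundary a s - coboundary b s) -sumrB.
by apply: eq_bigr => i _; rewrite -mulrBr.
Qed.

Definition cocycle (R : realType) (X : topologicalType) :
  {pred cochain R X 1} := [pred c | coboundary c == 0].

Lemma cocycle_zmod (R : realType) (X : topologicalType) :
  zmod_closed (@cocycle R X).
Proof.
split=> [|a b]; first by rewrite inE -{1}[0](subrr 0) coboundaryB subrr.
by move=> /eqP a0 /eqP b0; rewrite inE coboundaryB a0 b0 subrr.
Qed.

HB.instance Definition _ (R : realType) (X : topologicalType) :=
  GRing.isZmodClosed.Build _ (@cocycle R X) (@cocycle_zmod R X).

Record cocycles (R : realType) (X : topologicalType) := Cocycle {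
  cocycle_val :> cochain R X 1; _ : cocycle_val \in @cocycle R X }.

HB.instance Definition _ (R : realType) (X : topologicalType) :=
  [isSub for @cocycle_val R X].
HB.instance Definition _ (R : realType) (X : topologicalType) :=
  [Choice of cocycles R X by <:].
HB.instance Definition _ (R : realType) (X : topologicalType) :=
  [SubChoice_isSubZmodule of cocycles R X by <:].

Definition exact_cocycle (R : realType) (X : topologicalType) :
    {pred cocycles R X} :=
  [pred c | `[< exists b : cochain R X 0, coboundary b = val c >] ].

Lemma exact_cocycle_zmod (R : realType) (X : topologicalType) :
  zmod_closed (@exact_cocycle R X).
Proof.
split=> [|a b]; first by apply/asboolP; exists 0; 
    rewrite -[in LHS](subrr 0) coboundaryB subrr.
by move=> /asboolP[u ua] /asboolP[v vb]; apply/asboolP; exists (u - v);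
  rewrite coboundaryB ua vb raddfB.
Qed.

HB.instance Definition _ (R : realType) (X : topologicalType) :=
  GRing.isZmodClosed.Build _ (@exact_cocycle R X) (@exact_cocycle_zmod R X).

Notation H1 R X := (Quotient.quot (@exact_cocycle R X)).

Section Functoriality.
Variables (R : realType) (X Y : topologicalType) (f : continuousType X Y).

Definition pull_cochain (k : nat) (c : cochain R Y k) : cochain R X k :=
  fun s => c (f \o s : continuousType _ _).

Lemma coboundary_pull (k : nat) (c : cochain R Y k) :
  coboundary (pull_cochain c) = pull_cochain (coboundary c).
Proof.
apply/funext => s; apply: eq_bigr => i _; congr (_ * c _).
exact/continuousEP.
Qed.

Lemma pull_cocycle_subproof (c : cocycles R Y) :
  pull_cochain (val c) \in @cocycle R X.
Proof.
by have /eqP c0 := valP c; rewrite inE coboundary_pull c0.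
Qed.

Definition pull_cocycle (c : cocycles R Y) : cocycles R X :=
  Cocycle (pull_cocycle_subproof c).

Definition pullback (a : H1 R Y) : H1 R X := (\pi_(H1 R X) (pull_cocycle (repr a)))%qT.

Lemma pullback_pi (c : cocycles R Y) :
  pullback (\pi_(H1 R Y) c)%qT = (\pi_(H1 R X) (pull_cocycle c))%qT.
Proof.
apply/eqP; rewrite -Quotient.idealrBE; set d := repr _.
have : d - c \in @exact_cocycle R Y by rewrite Quotient.idealrBE /d reprK.
move=> /asboolP[b bE]; apply/asboolP; exists (pull_cochain b).
by rewrite coboundary_pull bE !raddfB.
Qed.

End Functoriality.

(* S^1 = R / Z: a loop is a 1-periodic map on R *)
Record loop (R : realType) (X : topologicalType) := Loop {
  loop_fun :> continuousType R X;
  loop_periodic : forall t : R, loop_fun (t + 1) = loop_fun t }.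

Lemma loop_map_periodic (R : realType) (X Y : topologicalType)
  (f : continuousType X Y) (g : loop R X) (t : R) : f (g (t + 1)) = f (g t).
Proof. by rewrite loop_periodic. Qed.

Definition loop_map (R : realType) (X Y : topologicalType)
    (f : continuousType X Y) (g : loop R X) : loop R Y :=
  Loop (loop_fun := f \o g : continuousType _ _) (loop_map_periodic f g).

Section Pairing.
Variables (R : realType) (X : topologicalType).

Definition simplex1_coord (x : set_type (@simplex R 1)) : R := val x 0 1.

Lemma simplex1_coord_continuous : continuous simplex1_coord.
Proof.
move=> x; apply: (@continuous_comp _ _ _ (fun y : set_type (@simplex R 1) => val y)
  (fun v : 'rV[R]_2 => v 0 1)); last exact: coord_continuous.
exact: (@initial_continuous _ _ set_val).
Qed.

HB.instance Definition _ :=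
  isContinuous.Build _ _ simplex1_coord simplex1_coord_continuous.

Definition loop_cycle (g : loop R X) : singular R 1 X :=
  g \o simplex1_coord : continuousType _ _.

Definition pairing (a : H1 R X) (g : loop R X) : int :=
  val (repr a) (loop_cycle g).

Lemma pairing_pi (c : cocycles R X) (g : loop R X) :
  pairing (\pi_(H1 R X) c)%qT g = val c (loop_cycle g).
Proof.
rewrite /pairing; set d := repr _; apply/eqP; rewrite -subr_eq0.
have : d - c \in @exact_cocycle R X by rewrite Quotient.idealrBE /d reprK.
move=> /asboolP[b bE].
have {}bE : coboundary b = val d - val c by rewrite bE raddfB.
have -> : val d (loop_cycle g) - val c (loop_cycle g) =
  coboundary b (loop_cycle g) by rewrite bE.
rewrite /coboundary !big_ord_recl big_ord0 /= expr0 mul1r addr0 expr1 mulN1r.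
rewrite subr_eq0; apply/eqP; congr (b _); apply/continuousEP => x /=.
have [_ /=] := set_valP x; rewrite big_ord1 => x1.
rewrite /simplex1_coord /= !mxE.
have -> : 1 = lift ord0 ord0 :> 'I_2 by apply/val_inj.
by rewrite liftK unlift_none /= x1 -{1}[1]add0r loop_periodic.
Qed.

End Pairing.

(* A k-tuple of vectors of R^m is the matrix of its rows, so that this is the
   type of skew-symmetric k-linear forms on R^m *)
Record exterior_form (R : realType) (k m : nat) := ExteriorForm {
  form_fun :> 'M[R]_(k, m) -> R;
  form_multilinear : forall (i : 'I_k) (A B C : 'M[R]_(k, m)) (b c : R),
    row i A = b *: row i B + c *: row i C ->
    row' i B = row' i A -> row' i C = row' i A ->
    form_fun A = b * form_fun B + c * form_fun C;
  form_skew : forall (i j : 'I_k) (A : 'M[R]_(k, m)), i != j ->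
    form_fun (xrow i j A) = - form_fun A }.

Definition form_ker (R : realType) (k m : nat) (w : exterior_form R k m) :
    set 'rV[R]_m :=
  [set v | forall (i : 'I_k) (A : 'M[R]_(k, m)),
    i = 0%N :> nat -> row i A = v -> w A = 0].

Definition independent_forms (R : realType) (k m : nat)
    (w1 w2 : exterior_form R k m) : Prop :=
  forall a b : R, (forall A, a * w1 A + b * w2 A = 0) -> a = 0 /\ b = 0.

Lemma sum_continuous (R : realType) (T : topologicalType) (I : Type)
  (r : seq I) (f : I -> T -> R) : (forall i, continuous (f i)) ->
  continuous (fun x => \sum_(i <- r) f i x).
Proof.
move=> cf; elim: r => [|i r IH] x.
  by under eq_fun do rewrite big_nil; exact: cvg_cst.
by under eq_fun do rewrite big_cons; apply: cvgD; [exact: cf|exact: IH].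
Qed.

Lemma prod_continuous (R : realType) (T : topologicalType) (I : Type)
  (r : seq I) (f : I -> T -> R) : (forall i, continuous (f i)) ->
  continuous (fun x => \prod_(i <- r) f i x).
Proof.
move=> cf; elim: r => [|i r IH] x.
  by under eq_fun do rewrite big_nil; exact: cvg_cst.
by under eq_fun do rewrite big_cons; apply: cvgM; [exact: cf|exact: IH].
Qed.

Lemma multilinear_expand (R : realType) (p m k : nat)
  (F : ('I_k -> 'rV[R]_m) -> R) (v : 'I_p -> 'rV[R]_m) (a : 'I_k -> 'I_p -> R) :
  (forall i u x y b c, u i = b *: x i + c *: y i ->
    (forall j, j != i -> x j = u j) -> (forall j, j != i -> y j = u j) ->
    F u = b * F x + c * F y) ->
  F (fun i => \sum_j a i j *: v j) =
  \sum_(f : {ffun 'I_k -> 'I_p}) (\prod_i a i (f i)) * F (fun i => v (f i)).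
Proof.
elim: k F a => [|k IHk] F a linF.
  rewrite (bigD1 (ffun0 (card_ord 0))) //= big_ord0 mul1r big1 ?addr0.
    by congr F; apply/funext => -[].
  by move=> f /eqP[]; apply/ffunP => -[].
pose cons x (u : 'I_k -> 'rV[R]_m) i := oapp u x (unlift ord0 i).
have Fcons x : F (cons x (fun i => \sum_j a (lift ord0 i) j *: v j)) =
    \sum_(g : {ffun 'I_k -> 'I_p})
      (\prod_i a (lift ord0 i) (g i)) * F (cons x (fun i => v (g i))).
  apply: (IHk (fun u => F (cons x u)) (fun i => a (lift ord0 i))).
  move=> i u y z b c ui yu zu; apply: (linF (lift ord0 i)).
  - by rewrite /cons liftK.
  - move=> j; rewrite /cons; case: unliftP => //= j' -> ne.
    by apply: yu; apply: contraNneq ne => ->.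
  - move=> j; rewrite /cons; case: unliftP => //= j' -> ne.
    by apply: zu; apply: contraNneq ne => ->.
have Fsum (I : seq 'I_p) u :
    F (cons (\sum_(j <- I) a ord0 j *: v j) u) =
    \sum_(j <- I) a ord0 j * F (cons (v j) u).
  elim: I => [|j I IH].
    rewrite !big_nil (linF ord0 _ (cons 0 u) (cons 0 u) 0 0) ?mul0r ?addr0 //.
    by rewrite /cons unlift_none /= scaler0 addr0.
  rewrite !big_cons -IH -[F (cons (\sum_(j <- I) _) u)]mul1r.
  apply: (linF ord0); first by rewrite /cons unlift_none /= scale1r.
    by move=> i; rewrite /cons; case: unliftP => [i'|] -> //; rewrite eqxx.
  by move=> i; rewrite /cons; case: unliftP => [i'|] -> //; rewrite eqxx.
transitivity (F (cons (\sum_j a ord0 j *: v j) (fun i => \sum_j a (lift ord0 i) j *: v j))).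
  by congr F; apply/funext => i; rewrite /cons; case: unliftP => [i'|] ->.
rewrite Fsum; under eq_bigr do rewrite Fcons big_distrr /=.
rewrite pair_big_dep /=.
pose h (jg : 'I_p * {ffun 'I_k -> 'I_p}) : {ffun 'I_k.+1 -> 'I_p} :=
  [ffun i => oapp jg.2 jg.1 (unlift ord0 i)].
rewrite [RHS](reindex h) /=; last first.
  exists (fun f => (f ord0, [ffun i => f (lift ord0 i)])) => [[j g] _|f _] /=.
    by rewrite !ffunE unlift_none; congr pair; apply/ffunP => i; rewrite !ffunE liftK.
  by apply/ffunP => i; rewrite !ffunE; case: unliftP => [i'|] -> //=; rewrite ffunE.
apply: eq_bigr => -[j g] _ /=; rewrite big_ord_recl mulrA; congr (_ * _ * _).
- by rewrite ffunE unlift_none.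
- by apply: eq_bigr => i _; rewrite ffunE liftK.
- by congr F; apply/funext => i; rewrite /cons ffunE; case: (unlift _ _).
Qed.

Section ExteriorForm.
Variables (R : realType) (k m : nat) (w : exterior_form R k m).

Lemma form_mulmx_expand p (A : 'M[R]_(k, p)) (B : 'M[R]_(p, m)) :
  w (A *m B) =
  \sum_(f : {ffun 'I_k -> 'I_p}) (\prod_i A i (f i)) * w (rowsub f B).
Proof.
pose F (u : 'I_k -> 'rV[R]_m) := w (\matrix_i u i).
have := @multilinear_expand R p m k F (fun i => row i B) (fun i j => A i j).
have -> : F (fun i => \sum_j A i j *: row j B) = w (A *m B).
  by congr (w _); apply/row_matrixP => i; rewrite rowK row_mul mulmx_sum_row;
     apply: eq_bigr => j _; rewrite mxE.
move=> ->; last first.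
  move=> i u x y b c ui xu yu; apply: (@form_multilinear _ _ _ w i).
  - by rewrite !rowK.
  - apply/row_matrixP => j; rewrite !row_rowsub !rowK xu //.
    by rewrite eq_sym neq_lift.
  - apply/row_matrixP => j; rewrite !row_rowsub !rowK yu //.
    by rewrite eq_sym neq_lift.
apply: eq_bigr => f _; congr (_ * w _); apply/row_matrixP => i.
by rewrite rowK row_rowsub.
Qed.

Lemma form_alternate (i j : 'I_k) (A : 'M[R]_(k, m)) :
  i != j -> row i A = row j A -> w A = 0.
Proof.
move=> ij Aij; have := form_skew w A ij.
have -> : xrow i j A = A.
  apply/row_matrixP => l; rewrite xrowEsub row_rowsub.
  by case: tpermP => // ->.
by move=> /eqP; rewrite -addr_eq0 -mulr2n mulrn_eq0 => /eqP.
Qed.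

Lemma form_row_perm (s : 'S_k) (A : 'M[R]_(k, m)) :
  w (row_perm s A) = (-1) ^+ s * w A.
Proof.
have [ts -> dts] := prod_tpermP s.
elim: ts dts => [_|t ts IH /= /andP[dt dts]].
  by rewrite big_nil odd_perm1 mul1r row_perm1.
rewrite big_cons row_permM -/(xrow _ _ _) form_skew // IH //.
by rewrite odd_mul_tperm dt -mulNr signrN.
Qed.

Lemma form_mulmx (G : 'M[R]_k) (A : 'M[R]_(k, m)) : w (G *m A) = \det G * w A.
Proof.
rewrite form_mulmx_expand (bigID (fun f : {ffun _ -> _} => injectiveb f)) /=.
rewrite [X in _ + X]big1 ?addr0 => [|f /injectivePn[i [j ij fij]]]; last first.
  by rewrite (form_alternate ij) ?mulr0 // !row_rowsub fij.
rewrite (reindex (@pval _)) /=; last first.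
  pose in_Sn := insubd (1%g : 'S_k).
  by exists in_Sn => /= f Uf; first apply: val_inj; apply: insubdK.
rewrite big_distrl; apply: eq_big => /= [s | s _]; rewrite ?(valP s) //.
have -> : rowsub (pval s) A = row_perm s A.
  by rewrite row_permEsub; apply/matrixP => i j; rewrite !mxE pvalE.
rewrite form_row_perm mulrCA mulrA; congr (_ * _ * _).
by apply: eq_bigr => i _; rewrite pvalE.
Qed.

Lemma form_continuous : continuous w.
Proof.
have -> : w = (fun A => \sum_(f : {ffun 'I_k -> 'I_m})
    (\prod_i A i (f i)) * w (rowsub f 1%:M)) :> ('M[R]_(k, m) -> R).
  by apply/funext => A; rewrite -{1}[A]mulmx1 form_mulmx_expand.
apply: sum_continuous => f A.
have cf : continuous (fun B : 'M[R]_(k, m) => \prod_i B i (f i)).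
  by apply: (@prod_continuous _ _ _ _ (fun i (B : 'M[R]_(k, m)) => B i (f i)))
    => i; exact: coord_continuous.
exact: (cvgM (cf A) (@cst_continuous _ R _ A)).
Qed.

Lemma form_row_free (A : 'M[R]_(k, m)) : w A != 0 -> row_free A.
Proof.
apply: contraNT => rA; have rk : (\rank A < k)%N.
  by rewrite ltn_neqAle rank_leq_row andbT.
rewrite -[A]mulmx_ebase -mulmxA form_mulmx; set B := _ *m row_ebase A.
have B0 : row (Ordinal rk) B = 0.
  rewrite row_mul (_ : row _ _ = 0) ?mul0mx //.
  by apply/rowP => j; rewrite !mxE /= ltnn andbF.
rewrite (@form_multilinear _ _ _ w (Ordinal rk) B B B 0 0) //.
  by rewrite !mul0r addr0 mulr0.
by rewrite B0 !scaler0 addr0.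
Qed.

End ExteriorForm.

(* As in vector.v, a subspace of R^m is the canonical generator matrix of a row
   space, so that equal subspaces are equal elements *)
Record grassmannian (R : realType) (k m : nat) := Grassmannian {
  gr_mx :> 'M[R]_m;
  _ : (<<gr_mx>>%MS == gr_mx) && (\rank gr_mx == k) }.

HB.instance Definition _ (R : realType) (k m : nat) :=
  [isSub for @gr_mx R k m].
HB.instance Definition _ (R : realType) (k m : nat) :=
  [Choice of grassmannian R k m by <:].

Definition orth_proj (R : realType) (k m : nat) (W : grassmannian R k m) :
    'M[R]_m :=
  proj_mx W (kermx W^T).

(* The topology and the smooth structure of the Grassmannian are those of the
   submanifold of orthogonal projection matrices of rank k *)
HB.instance Definition _ (R : realType) (k m : nat) :=
  Topological.copy (grassmannian R k m) (initial_topology (@orth_proj R k m)).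

Lemma span_subproof (R : realType) (k m : nat) (U : 'M[R]_(k, m)) :
  row_free U ->
  (<<<<U>>%MS>>%MS == <<U>>%MS) && (\rank <<U>>%MS == k).
Proof. by move=> /eqP rU; rewrite genmx_id eqxx mxrank_gen rU /=. Qed.

Definition span (R : realType) (k m : nat) (U : 'M[R]_(k, m))
    (fU : row_free U) : grassmannian R k m :=
  Grassmannian (span_subproof fU).

Section GrassmannianTheory.
Variables (R : realType) (k m : nat).
Implicit Types W : grassmannian R k m.

Lemma gr_eqP W1 W2 : reflect (W1 = W2) (W1 == W2)%MS.
Proof.
apply: (iffP idP) => [/genmxP e|->]; last by rewrite submx_refl.
apply: val_inj => /=.
by case: W1 W2 e => [A /andP[/eqP + _]] [B /andP[/eqP + _]] /= e; rewrite e => -> ->.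
Qed.

Lemma mul_trmx_eq0 (v : 'rV[R]_m) : v *m v^T = 0 -> v = 0.
Proof.
move=> /matrixP/(_ 0 0); rewrite !mxE => v0; apply/rowP => j; rewrite mxE.
have := psumr_eq0P (P := predT) (F := fun j => v 0 j ^+ 2) (fun i _ => sqr_ge0 _).
rewrite (eq_bigr (fun j => v 0 j * v^T j 0)) => [|i _]; last by rewrite mxE.
by move=> /(_ v0 j isT) /eqP; rewrite sqrf_eq0 => /eqP.
Qed.

Lemma orth_compl_cap0 W : (W :&: kermx W^T = 0)%MS.
Proof.
apply/eqP; rewrite -submx0; apply/row_subP => i; set v := row i _.
have : (v <= W :&: kermx W^T)%MS by exact: row_sub.
rewrite sub_capmx => /andP[/submxP[x vE] /sub_kermxP vW].
rewrite (mul_trmx_eq0 (v := v)) ?sub0mx // {2}vE trmx_mul mulmxA vW mul0mx //.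
Qed.

Lemma orth_proj_id W p (A : 'M[R]_(p, m)) : (A <= W)%MS -> A *m orth_proj W = A.
Proof. exact/proj_mx_id/orth_compl_cap0. Qed.

Lemma orth_proj_sub W p (A : 'M[R]_(p, m)) : (A *m orth_proj W <= W)%MS.
Proof. exact: proj_mx_sub. Qed.

Lemma orth_proj_continuous : continuous (@orth_proj R k m).
Proof. exact: (@initial_continuous _ _ (@orth_proj R k m)). Qed.

End GrassmannianTheory.

Notation RP1 R := (grassmannian R 1 2).

Definition row2 (R : realType) (a b : R) : 'rV[R]_2 :=
  \row_i (if i == 0 then a else b).

Lemma row2_free (R : realType) (a b : R) :
  a != 0 \/ b != 0 -> row_free (row2 a b).
Proof.
move=> ab; rewrite /row_free rank_rV; suff -> : row2 a b != 0 by [].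
apply/eqP => /matrixP e; have := e 0 1; have := e 0 0; rewrite !mxE /=.
by move=> a0 b0; case: ab; rewrite ?a0 ?b0 eqxx.
Qed.

(* [a : b] *)
Definition hpoint (R : realType) (a b : R) (h : a != 0 \/ b != 0) : RP1 R :=
  span (row2_free h).

Lemma orth_proj_hpoint (R : realType) (a b : R) (h : a != 0 \/ b != 0) i j :
  orth_proj (hpoint h) i j =
  row2 a b 0 i * row2 a b 0 j / (a ^+ 2 + b ^+ 2).
Proof.
set u := row2 a b; set d := _ + _; set Q := orth_proj _.
have d0 : d != 0.
  by rewrite paddr_eq0 ?sqr_ge0 // !sqrf_eq0; case: (h) => /negPf->; rewrite ?andbF.
have uQ : u *m Q = u by apply: orth_proj_id; rewrite /= genmxE.
have uu : u *m u^T = d%:M.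
  apply/matrixP => x y; rewrite !mxE !ord1 !big_ord_recl big_ord0 !mxE /=.
  by rewrite addr0 -!expr2.
pose v := delta_mx 0 i - (u 0 i / d) *: u.
have vQ : v *m Q = 0.
  apply: proj_mx_0; first exact: orth_compl_cap0.
  apply/sub_kermxP => /=; apply/trmx_inj; rewrite trmx_mul trmxK trmx0.
  have /submxP[x ->] : (<<u>> <= u)%MS by rewrite genmxE.
  rewrite -mulmxA (_ : u *m v^T = 0) ?mulmx0 //.
  rewrite /v linearB /= linearZ /= mulmxBr -scalemxAr uu.
  rewrite trmx_delta -colE; apply/matrixP => r s; rewrite !mxE !ord1 eqxx mulr1n.
  by rewrite divfK // subrr.
move: vQ; rewrite /v mulmxBl -scalemxAl uQ -rowE => /eqP; rewrite subr_eq0.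
by move=> /eqP/rowP/(_ j); rewrite !mxE mulrAC.
Qed.

Section PencilMap.
Variables (R : realType) (k m : nat) (w1 w2 : exterior_form R k m).

Definition pencil_domain : set (grassmannian R k m) :=
  [set W | exists U : 'M[R]_(k, m),
    (U == W)%MS /\ (w1 U != 0 \/ w2 U != 0)].

Definition pencil_map (W : set_type pencil_domain) : RP1 R :=
  hpoint (projT2 (cid (set_valP W))).2.

Lemma pencil_mapE (W : set_type pencil_domain) (U : 'M[R]_(k, m))
  (h : w1 U != 0 \/ w2 U != 0) : (U == val W)%MS -> pencil_map W = hpoint h.
Proof.
rewrite /pencil_map; case: cid => U' /= [U'W h'] UW.
have /submxP[G UG] : (U <= U')%MS.
  by rewrite (eqmxP UW) (eqmxP U'W).
have G0 : \det G != 0.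
  by apply: contraTneq isT => G0; case: h; rewrite UG form_mulmx G0 mul0r eqxx.
apply/gr_eqP/eqmxP => /=; apply: (eqmx_trans (genmxE _)).
apply: eqmx_sym; apply: (eqmx_trans (genmxE _)).
have -> : row2 (w1 U) (w2 U) = \det G *: row2 (w1 U') (w2 U').
  by apply/rowP => i; rewrite !mxE UG !form_mulmx; case: ifP.
exact: eqmx_scale.
Qed.

Lemma pencil_map_continuous : continuous pencil_map.
Proof.
apply: (@continuous_comp_initial _ _ _ (@orth_proj R 1 2)).
apply: mx_continuous => i j W0.
have [U0 [UW0 h0]] := set_valP W0.
pose U (W : set_type pencil_domain) := U0 *m orth_proj (val W).
have cU : continuous U.
  apply: mx_continuous => a b; rewrite /U.
  under eq_fun do rewrite mxE.
  apply: sum_continuous => l W.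
  have cW : continuous (fun W : set_type pencil_domain => orth_proj (val W) l b).
    move=> W'; apply: (continuous_comp
      (f := @set_val _ pencil_domain) (g := fun V => orth_proj V l b)).
      exact: (@initial_continuous _ _ set_val).
    apply: (continuous_comp (f := @orth_proj R k m) (g := fun A => A l b)).
      exact: orth_proj_continuous.
    exact: coord_continuous.
  exact: (cvgM (@cst_continuous _ R _ W) (cW W)).
have UW00 : U W0 = U0 by apply: orth_proj_id; rewrite -(eqmxP UW0).
have cw (w : exterior_form R k m) : continuous (w \o U).
  by move=> W; exact: (continuous_comp (cU W) (@form_continuous _ _ _ w _)).
have near_h : \forall W \near W0, w1 (U W) != 0 \/ w2 (U W) != 0.
  have near_w (w : exterior_form R k m) : w U0 != 0 ->
      \forall W \near W0, w (U W) != 0.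
    move=> w0; apply: (cw w W0 [set x : R | x != 0]); apply: open_nbhs_nbhs; split.
      exact: open_neq.
    by rewrite /= UW00.
  by case: h0 => /near_w; apply: filterS => W ?; [left|right].
pose q (W : set_type pencil_domain) :=
  row2 (w1 (U W)) (w2 (U W)) 0 i * row2 (w1 (U W)) (w2 (U W)) 0 j /
  (w1 (U W) ^+ 2 + w2 (U W) ^+ 2).
have qE (W : set_type pencil_domain) :
    w1 (U W) != 0 \/ w2 (U W) != 0 -> orth_proj (pencil_map W) i j = q W.
  move=> h; rewrite (pencil_mapE h) ?orth_proj_hpoint //.
  have fU : row_free (U W) by case: h => /form_row_free.
  have UW : (U W <= val W)%MS by exact: orth_proj_sub.
  rewrite -(geq_leqif (mxrank_leqif_eq UW)) (eqP fU).
  by case: (val W) => ? /= /andP[_ /eqP->].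
have cq : {for W0, continuous q}.
  have cr l : continuous (fun W => row2 (w1 (U W)) (w2 (U W)) 0 l).
    rewrite /row2; under eq_fun do rewrite mxE.
    by case: (l == 0); exact: cw.
  have d0 : w1 (U W0) ^+ 2 + w2 (U W0) ^+ 2 != 0.
    rewrite UW00 paddr_eq0 ?sqr_ge0 // !sqrf_eq0.
    by case: (h0) => /negPf->; rewrite ?andbF.
  have cd : continuous (fun W => w1 (U W) ^+ 2 + w2 (U W) ^+ 2).
    move=> W; exact: (cvgD (cvgM (cw w1 W) (cw w1 W)) (cvgM (cw w2 W) (cw w2 W))).
  exact: (cvgM (cvgM (cr i W0) (cr j W0)) (cvgV d0 (cd W0))).
rewrite /continuous_at /= qE ?UW00 //.
have e : \forall W \near W0, q W = orth_proj (pencil_map W) i j.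
  by apply: filterS near_h => W /qE.
exact: (cvg_trans (near_eq_cvg e) cq).
Qed.

HB.instance Definition _ :=
  isContinuous.Build _ _ pencil_map pencil_map_continuous.

End PencilMap.

Section ProjectiveLine.
Variable R : realType.

Lemma cos_sin_neq0 (x : R) : cos x != 0 \/ sin x != 0.
Proof.
apply/orP; rewrite -negb_and; apply/negP => /andP[/eqP c0 /eqP s0].
by have /eqP := cos2Dsin2 x; rewrite c0 s0 expr0n addr0 eq_sym oner_eq0.
Qed.

Definition rp1_angle (x : R) : RP1 R := hpoint (cos_sin_neq0 x).

Lemma rp1_angle_continuous : continuous rp1_angle.
Proof.
apply: (@continuous_comp_initial _ _ _ (@orth_proj R 1 2)).
apply: mx_continuous => i j x /=.
under eq_fun do rewrite /rp1_angle orth_proj_hpoint cos2Dsin2 divr1.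
have cr l : continuous (fun y : R => row2 (cos y) (sin y) 0 l).
  rewrite /row2; under eq_fun do rewrite mxE.
  by case: (l == 0); [exact: continuous_cos|exact: continuous_sin].
exact: (cvgM (cr i x) (cr j x)).
Qed.

(* The orientation o = false is that of increasing x in [cos x : sin x] and
   o = true is the opposite one; RP^1 is connected, so there are no others *)
Definition rp1_turn (o : bool) (t : R) : RP1 R :=
  rp1_angle ((-1) ^+ o * pi * t).

Lemma rp1_turn_continuous (o : bool) : continuous (rp1_turn o).
Proof.
move=> t; have ct : continuous (fun t : R => (-1) ^+ o * pi * t).
  by move=> u; apply: cvgM; [exact: cvg_cst|exact: cvg_id].
exact: (continuous_comp (ct t) (@rp1_angle_continuous _)).
Qed.

HB.instance Definition _ (o : bool) :=
  isContinuous.Build _ _ (rp1_turn o) (@rp1_turn_continuous o).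

Lemma rp1_turn_periodic (o : bool) (t : R) : rp1_turn o (t + 1) = rp1_turn o t.
Proof.
rewrite /rp1_turn mulrDr mulr1; set x := _ * t.
apply/gr_eqP/eqmxP => /=; apply: (eqmx_trans (genmxE _)).
apply: eqmx_sym; apply: (eqmx_trans (genmxE _)).
have -> : row2 (cos (x + (-1) ^+ o * pi)) (sin (x + (-1) ^+ o * pi)) =
    (-1) *: row2 (cos x) (sin x).
  apply/rowP => i; rewrite !mxE mulN1r (fun_if -%R).
  case: o @x => x; rewrite ?mulN1r ?mul1r ?cosDpi ?sinDpi //.
  by rewrite -[x in RHS](subrK pi) cosDpi sinDpi !opprK.
by apply: eqmx_sym; apply: eqmx_scale; rewrite oppr_eq0 oner_eq0.
Qed.

Definition rp1_loop (o : bool) : loop R (RP1 R) :=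
  Loop (loop_fun := rp1_turn o) (rp1_turn_periodic o).

Definition orientation_generator (o : bool) (mu : H1 R (RP1 R)) : Prop :=
  (forall a : H1 R (RP1 R), exists z : int, a = mu *~ z) /\
  pairing mu (rp1_loop o) = 1.

Definition winding_number (o : bool) (d : loop R (RP1 R)) (z : int) : Prop :=
  exists theta : R -> R,
    [/\ continuous theta, forall t, d t = rp1_angle (theta t) &
        theta 1 - theta 0 = (-1) ^+ o * pi * z%:~R].

End ProjectiveLine.

Section SmoothCurves.
Variables (R : realType) (k m : nat).
Implicit Types (c : R -> grassmannian R k m) (W : grassmannian R k m)
  (S : set (grassmannian R k m)).

Definition smooth_curve c : Prop :=
  forall i j l t, derivable (derive1n l (fun s => orth_proj (c s) i j)) t 1.

Definition velocity c (t : R) : 'M[R]_m :=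
  \matrix_(i, j) derive1 (fun s => orth_proj (c s) i j) t.

(* T_W S, for a submanifold S through W *)
Definition tangent S W : set 'M[R]_m :=
  [set X | exists c, [/\ smooth_curve c, c 0 = W,
    \forall t \near 0, S (c t) & velocity c 0 = X]].

(* The tangent vectors Y at W whose class in the line
   T_W Gr / T_W S is a positive multiple of that of X *)
Definition normal_ray S W (X : 'M[R]_m) : set 'M[R]_m :=
  [set Y | tangent setT W Y /\
    exists2 a : R, 0 < a & tangent S W (Y - a *: X)].

End SmoothCurves.

Section MaslovArnold.
Variables (R : realType) (n : nat).
Local Notation Gr := (grassmannian R n (2 * n)).
Implicit Types (P W : Gr) (M : set Gr) (c : R -> Gr).

Definition train P : set Gr := [set W | (W :&: P)%MS != 0].

Definition train1 P : set Gr := [set W | \rank (W :&: P)%MS = 1%N].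

Definition sufficiently_generic P c : Prop :=
  [/\ smooth_curve c,
      forall t, train P (c t) -> train1 P (c t) &
      forall t, train1 P (c t) -> ~ tangent (train1 P) (c t) (velocity c t)].

(* pos W is the set of the tangent vectors at W whose class in the normal line
   nu_W is positive; it must be locally given by a continuous section of nu *)
Definition coorientation P M (pos : Gr -> set 'M[R]_(2 * n)) : Prop :=
  forall W0, train1 P W0 -> M W0 ->
  exists2 U : set Gr, nbhs W0 U &
  exists2 X : Gr -> 'M[R]_(2 * n),
    {within U `&` (train1 P `&` M), continuous X} &
    forall W, (U `&` (train1 P `&` M)) W ->
    [/\ tangent setT W (X W), ~ tangent (train1 P) W (X W) &
        pos W = normal_ray (train1 P) W (X W)].

Definition crossing_times P c : set R :=
  [set t | 0 <= t < 1 /\ train P (c t)].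

Definition crossing_sign (pos : Gr -> set 'M[R]_(2 * n)) c (t : R) : int :=
  if velocity c t \in pos (c t) then 1 else -1.

Definition intersection_number P (pos : Gr -> set 'M[R]_(2 * n)) c (z : int) :
    Prop :=
  finite_set (crossing_times P c) /\
  \sum_(t \in crossing_times P c) crossing_sign pos c t = z.

Definition maslov_arnold M P (alpha : H1 R (set_type M)) : Prop :=
  (forall k : nat, (0 < k)%N -> alpha *+ k != 0) /\
  exists2 pos, coorientation P M pos &
    forall gamma : loop R (set_type M),
      sufficiently_generic P (fun t => val (gamma t)) ->
      intersection_number P pos (fun t => val (gamma t)) (pairing alpha gamma).

End MaslovArnold.

(* Main.v *)
Require Import Defs.
From HB Require Import structures.
From mathcomp Require Import all_boot all_order all_algebra perm.
From mathcomp Require Import all_classical all_reals all_analysis.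
From mathcomp Require Import ring lra zify.

(* The form w1 descends to a volume form on V / P, so that the train of P is
   {w1 = 0}, and within the pencil domain M it is the fibre of phi over [0 : 1].
   At W in the smooth part of the train and in M, the function w1 / w2 is
   defined near W and the kernel of its differential in T_W Gr is exactly the
   tangent space of the train, so that its sign co-orients the train.  Lift
   phi o gamma to an angle x(t): the crossings are the t with x(t) in
   pi / 2 + pi Z, and the sign of a crossing is the direction in which x crosses
   that value, so the signed count is the winding number.

   The pairing <alpha, gamma> is computed by the explicit cocycle that sends a
   singular 1-simplex s to the integer (dx - db) / (+- pi), where x is a lift of s
   to angles and b is a discontinuous choice of an angle for each point of RP^1.
   Its class pairs to 1 with the standard loop, hence equals mu.

   Finally alpha has infinite order because rotating one row of a suitable
   matrix from a vector of P to a vector outside P gives a loop in M on which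
   phi has degree +-1. *)

Set Implicit Arguments.
Unset Strict Implicit.
Unset Printing Implicit Defensive.
Import Order.TTheory GRing.Theory Num.Theory numFieldNormedType.Exports.

Local Open Scope classical_set_scope.
Local Open Scope ring_scope.

(** * Rows of matrices and skew-symmetric forms *)

(** The lift x is only known to be continuous, even when gamma is smooth, so the direction of a
    crossing cannot be read off from a derivative of x. The differentiable quantity is [w1] on a
    moving basis; the identity w1 sin x = w2 cos x carries its change of sign over to x. The count
    then concerns a continuous function that passes each integer value in a prescribed direction.
    Tangent spaces are defined by velocities of curves, so membership in one has to be witnessed by
    a curve. Every curve built here is the span of a matrix affine in t, and tangency is tested by
    linear algebra on projection matrices. The correction db makes the cocycle an integer on every
    simplex, not only on loops. It depends on the endpoints alone, so it cancels over the faces of a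
    2-simplex and vanishes on loops. *)

Section SetRow.
Variables (R : nzRingType) (k m : nat).

Definition setrow (i : 'I_k) (v : 'rV[R]_m) (A : 'M[R]_(k, m)) : 'M[R]_(k, m) :=
  \matrix_j (if j == i then v else row j A).

Lemma row_setrow i v A j :
  row j (setrow i v A) = if j == i then v else row j A.
Proof. exact: rowK. Qed.

Lemma row_setrow_id i v A : row i (setrow i v A) = v.
Proof. by rewrite row_setrow eqxx. Qed.

Lemma setrow_row i A : setrow i (row i A) A = A.
Proof. by apply/row_matrixP => j; rewrite row_setrow; case: eqP => [->|]. Qed.

Lemma row'_setrow i v A : row' i (setrow i v A) = row' i A.
Proof.
apply/row_matrixP => j; rewrite !row_rowsub row_setrow.
by rewrite eq_sym (negPf (neq_lift _ _)).
Qed.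

Lemma setrowE i v A : setrow i v A = A + delta_mx i 0 *m (v - row i A).
Proof.
apply/matrixP => j l; rewrite !mxE big_ord1 !mxE eqxx andbT.
by case: eqP => [->|_]; rewrite ?mxE ?mul0r ?addr0 // mul1r addrC subrK.
Qed.

End SetRow.

Lemma setrow_mulmx (R : nzRingType) (k p m : nat) (i : 'I_k) (v : 'rV[R]_p)
    (A : 'M[R]_(k, p)) (B : 'M[R]_(p, m)) :
  setrow i v A *m B = setrow i (v *m B) (A *m B).
Proof.
by apply/row_matrixP => j; rewrite row_mul !row_setrow; case: eqP; rewrite ?row_mul.
Qed.

(** The cofactors along row [i] do not see that row, so they are those of the identity matrix, read
    off from its adjugate. *)
Lemma det_setrow1 (R : comNzRingType) (k : nat) (i : 'I_k) (g : 'rV[R]_k) :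
  \det (setrow i g 1%:M) = g 0 i.
Proof.
have cofE j : cofactor (setrow i g 1%:M) i j = (j == i)%:R.
  transitivity ((\adj (1%:M : 'M[R]_k)) j i); last first.
    by rewrite -[\adj _]mulmx1 mul_adj_mx det1 mxE.
  rewrite mxE /cofactor; congr (_ * \det _); apply/matrixP => a b.
  by rewrite !mxE eq_sym (negPf (neq_lift _ _)) !mxE.
rewrite (expand_det_row _ i) (bigD1 i) //= big1 ?addr0 => [|j /negPf ji].
  by rewrite cofE !mxE eqxx mulr1.
by rewrite cofE ji mulr0.
Qed.

Section FormRows.
Variables (R : realType) (k m : nat) (w : exterior_form R k m).
Implicit Types (A U : 'M[R]_(k, m)) (i : 'I_k).

Lemma form_setrow_lin i A b c (u v : 'rV[R]_m) :
  w (setrow i (b *: u + c *: v) A) = b * w (setrow i u A) + c * w (setrow i v A).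
Proof.
by apply: (@form_multilinear _ _ _ _ i); rewrite ?row_setrow_id ?row'_setrow.
Qed.

Lemma form_setrowD i A (u v : 'rV[R]_m) :
  w (setrow i (u + v) A) = w (setrow i u A) + w (setrow i v A).
Proof. by rewrite -[u in LHS]scale1r -[v in LHS]scale1r form_setrow_lin !mul1r. Qed.

Lemma form_setrowZ i A b (u : 'rV[R]_m) :
  w (setrow i (b *: u) A) = b * w (setrow i u A).
Proof.
by rewrite -[b *: u]addr0 -(scale0r u) form_setrow_lin mul0r addr0.
Qed.

Lemma form_setrow_comb i U (g : 'rV[R]_k) :
  w (setrow i (g *m U) U) = g 0 i * w U.
Proof.
have -> : setrow i (g *m U) U = setrow i g 1%:M *m U by rewrite setrow_mulmx mul1mx.
by rewrite form_mulmx det_setrow1.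
Qed.

(** [form_ker] tests a vector in row 0 only; skew-symmetry moves it to any other row. *)
Lemma form_ker_row i A : form_ker w (row i A) -> w A = 0.
Proof.
move=> kA; have k0 : (0 < k)%N by exact: leq_ltn_trans (ltn_ord i).
pose z := Ordinal k0; have [iz|iz] := eqVneq i z; first by apply: (kA i); rewrite ?iz.
have := form_skew w A iz; rewrite (kA z (xrow i z A)) //; last first.
  by apply/rowP => j; rewrite !mxE tpermR.
by move=> /eqP; rewrite eq_sym oppr_eq0 => /eqP.
Qed.

(** The form descends to the quotient by its kernel. The hybrids [H l] take their first [l] rows
    from [A] and the others from [B]; consecutive ones differ in one row by a kernel vector. *)
Lemma form_eq_mod_ker A B :
  (forall i, form_ker w (row i A - row i B)) -> w A = w B.
Proof.
move=> AB.
pose H l : 'M[R]_(k, m) := \matrix_j (if (j < l)%N then row j A else row j B).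
have HS (l : nat) : (l < k)%N -> w (H l.+1) = w (H l).
  move=> lk; pose i := Ordinal lk.
  have -> : H l.+1 = setrow i (row i B + (row i A - row i B)) (H l).
    apply/row_matrixP => j; rewrite row_setrow !rowK addrC subrK.
    rewrite ltnS leq_eqVlt -val_eqE /=.
    by case: eqP => //= jl; congr (row _ A); apply/val_inj.
  rewrite form_setrowD (@form_ker_row i (setrow i (row i A - row i B) _)) ?addr0.
    congr (w _); apply/row_matrixP => j; rewrite row_setrow; case: eqP => // ->.
    by rewrite rowK ltnn.
  by rewrite row_setrow_id.
have HE l : (l <= k)%N -> w (H l) = w (H 0%N).
  by elim: l => // l IH lk; rewrite HS // IH // ltnW.
transitivity (w (H k)).
  by congr (w _); apply/row_matrixP => j; rewrite rowK ltn_ord.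
by rewrite HE //; congr (w _); apply/row_matrixP => j; rewrite rowK.
Qed.

End FormRows.

Section TopForm.
Variables (R : realType) (k m p : nat) (w : exterior_form R k m) (P : 'M[R]_(p, m)).
Hypothesis ker_w : forall v : 'rV[R]_m, form_ker w v <-> (v <= P)%MS.
Hypotheses (k_gt0 : (0 < k)%N) (rank_P : (\rank P + k)%N = m).
Implicit Types (U : 'M[R]_(k, m)).

Let K := cokermx P.

(** [K] is the quotient map modulo P, of rank k. If g U lies in P, then putting it in row i kills
    [w], while the value is g_i w(U), so g = 0. Conversely, if U K spans the image of [K], a matrix
    B with w(B) nonzero is congruent to some C U, and w(B) = det C w(U). *)
Lemma form_neq0_free U : (w U != 0) = row_free (U *m K).
Proof.
apply/idP/idP => [wU|fU].
  rewrite -kermx_eq0; apply/eqP/row_matrixP => j; rewrite row0.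
  have : row j (kermx (U *m K)) *m (U *m K) = 0.
    by rewrite -row_mul mulmx_ker row0.
  move: (row j _) => g gUK; apply/rowP => i; rewrite [RHS]mxE.
  have := form_setrow_comb w i U g; rewrite (@form_ker_row _ _ _ _ i).
    by move=> /esym/eqP; rewrite mulf_eq0 (negPf wU) orbF => /eqP.
  by rewrite row_setrow_id; apply/ker_w; rewrite submxE -mulmxA gUK.
have [B wB] : exists B, w B != 0.
  apply: contrapT => /forallNP w0; have : (\rank (1%:M : 'M[R]_m) <= \rank P)%N.
    apply/mxrankS/row_subP => i; apply/ker_w => j A _ _.
    by have /negP := w0 A; rewrite negbK => /eqP.
  rewrite mxrank1 => mP; have : (\rank P + k <= \rank P + 0)%N by rewrite rank_P addn0.
  by rewrite leq_add2l leqNgt k_gt0.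
have rK : \rank K = k.
  by rewrite mxrank_coker -[in X in (X - _)%N]rank_P addKn.
have KU : (K <= U *m K)%MS.
  by rewrite -(geq_leqif (mxrank_leqif_sup (submxMl U K))) rK (eqP fU).
have /submxP[C BC] := submx_trans (submxMl B K) KU.
have := form_eq_mod_ker (w := w) (A := B) (B := C *m U).
rewrite form_mulmx => e; move: wB; rewrite e ?mulf_eq0 ?negb_or => [/andP[]//|i].
by apply/ker_w; rewrite -linearB /= submxE -row_mul mulmxBl BC mulmxA subrr row0.
Qed.

End TopForm.

(** * Orthogonal projections as coordinates on the Grassmannian *)

Section OrthProj.
Variables (R : realType) (k m : nat).
Implicit Types W : grassmannian R k m.

Lemma gr_rank W : \rank W = k.
Proof. by case: W => A /= /andP[_ /eqP]. Qed.

(** The rows of 1 - Q are orthogonal to W and those of Q lie in W, so (1 - Q) Q^T = 0. Hence Q^T = Q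
    Q^T, which is symmetric. *)
Lemma orth_proj_sym W : (orth_proj W)^T = orth_proj W.
Proof.
set Q := orth_proj W.
have full : (1%:M <= (W : 'M[R]_m) + kermx (W : 'M[R]_m)^T)%MS.
  rewrite sub1mx /row_full mxrank_disjoint_sum ?orth_compl_cap0 //.
  by rewrite mxrank_ker mxrank_tr subnKC // rank_leq_col.
have := proj_mx_compl_sub full; rewrite mul1mx -/(orth_proj W) -/Q => /sub_kermxP QW.
have /submxP[Z QZ] : (Q <= W)%MS by rewrite -[Q]mul1mx orth_proj_sub.
have QQ : Q^T = Q *m Q^T.
  apply/eqP; rewrite -subr_eq0 -[X in X - _]mul1mx -mulmxBl.
  by rewrite {2}QZ trmx_mul mulmxA QW mul0mx.
have QQ2 : Q = (Q *m Q^T)^T by rewrite -QQ trmxK.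
by rewrite {2}QQ2 [RHS]trmx_mul trmxK.
Qed.

Lemma orth_proj_idem W : orth_proj W *m orth_proj W = orth_proj W.
Proof. by apply: orth_proj_id; rewrite -[orth_proj W]mul1mx orth_proj_sub. Qed.

(** If g U U^T = 0 then g U is orthogonal to itself, hence zero over the reals. *)
Lemma gram_unit (U : 'M[R]_(k, m)) : row_free U -> U *m U^T \in unitmx.
Proof.
move=> fU; rewrite -row_free_unit -kermx_eq0; apply/eqP/row_matrixP => j.
have : row j (kermx (U *m U^T)) *m (U *m U^T) = 0.
  by rewrite -row_mul mulmx_ker row0.
rewrite row0; move: (row j _) => g gU.
suff : g *m U = 0 by rewrite -(mul0mx _ U) => /(row_free_inj fU).
by apply: mul_trmx_eq0; rewrite trmx_mul mulmxA -(mulmxA g) gU mul0mx.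
Qed.

(** The right side E is symmetric and fixes the rows of [U], so E Q = E and Q E = Q; transposing the
    first relation gives Q E = E. This formula in an arbitrary basis is the source of all continuity
    and smoothness statements on subspaces. *)
Lemma orth_projE W (U : 'M[R]_(k, m)) : (U == W)%MS ->
  orth_proj W = U^T *m invmx (U *m U^T) *m U.
Proof.
move=> UW; set Q := orth_proj W.
have fU : row_free U by rewrite /row_free (eqmxP UW) gr_rank.
have gU := gram_unit fU.
set E := _ *m U.
have UE : U *m E = U by rewrite /E !mulmxA mulmxV // mul1mx.
have Esym : E^T = E.
  by rewrite /E !trmx_mul trmxK trmx_inv trmx_mul trmxK mulmxA.
have EQ : E *m Q = E by apply: orth_proj_id; rewrite -(eqmxP UW) submxMl.
have QE : Q *m E = Q.
  have /submxP[Z ->] : (Q <= U)%MS by rewrite (eqmxP UW) -[Q]mul1mx orth_proj_sub.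
  by rewrite -mulmxA UE.
by rewrite -Esym -EQ trmx_mul Esym orth_proj_sym.
Qed.

Lemma span_eqmx (U : 'M[R]_(k, m)) (fU : row_free U) : (U == Defs.span fU)%MS.
Proof. by rewrite /= !genmxE submx_refl. Qed.

Lemma eqmx_span W (U : 'M[R]_(k, m)) : (U <= W)%MS -> row_free U -> (U == W)%MS.
Proof.
by move=> UW fU; rewrite -(geq_leqif (mxrank_leqif_eq UW)) (eqP fU) gr_rank.
Qed.

Lemma gr_basis W : exists U : 'M[R]_(k, m), (U == W)%MS.
Proof.
suff rk (A : 'M[R]_m) r : \rank A = r -> exists U : 'M[R]_(r, m), (U == A)%MS.
  exact/rk/gr_rank.
by move=> <-; exists (row_base A); apply/eqmxP; exact: eq_row_base.
Qed.

End OrthProj.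

(** * Derivatives and continuity of matrix-valued maps *)

Section Derive.
Variable R : realType.

Lemma is_derive_bigsum (I : Type) (r : seq I) (f : I -> R -> R) (df : I -> R) (t : R) :
  (forall i, is_derive t 1 (f i) (df i)) ->
  is_derive t 1 (fun s => \sum_(i <- r) f i s) (\sum_(i <- r) df i).
Proof.
move=> fd; elim: r => [|i r IH].
  under eq_fun do rewrite big_nil.
  by rewrite big_nil; exact: is_derive_cst.
rewrite big_cons (_ : (fun _ => _) = f i + (fun s => \sum_(j <- r) f j s)).
  exact: (is_deriveD (fd i) IH).
by apply/funext => s; rewrite big_cons.
Qed.

Lemma is_derive_bigprod (I : eqType) (r : seq I) (f : I -> R -> R) (df : I -> R) (t : R) :
  uniq r -> (forall i, is_derive t 1 (f i) (df i)) ->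
  is_derive t 1 (fun s => \prod_(i <- r) f i s)
    (\sum_(i <- r) \prod_(j <- r) (if j == i then df j else f j t)).
Proof.
move=> + fd; elim: r => [_|i r IH /= /andP[ir ur]].
  under eq_fun do rewrite big_nil.
  by rewrite big_nil; exact: is_derive_cst.
rewrite (_ : (fun s => \prod_(j <- i :: r) f j s) =
    (f i * (fun s => \prod_(j <- r) f j s)) :> (R -> R)); last first.
  by apply/funext => s; rewrite big_cons.
apply: (is_derive_eq (is_deriveM (fd i) (IH ur))).
rewrite big_cons addrC; congr (_ + _).
  rewrite big_cons eqxx [LHS]mulrC; congr (_ * _); apply: eq_big_seq => j jr.
  by case: eqP jr ir => // -> ->.
rewrite [LHS]big_distrr /=; apply: eq_big_seq => j jr; rewrite big_cons.
by case: eqP jr ir => // <- ->.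
Qed.

(** The differential of [w] at [U] in the direction [A], by the Leibniz rule for a multilinear
    map. *)
Definition dform (k m : nat) (w : exterior_form R k m) (U A : 'M[R]_(k, m)) : R :=
  \sum_i w (setrow i (row i A) U).

Lemma form_expand (k m : nat) (w : exterior_form R k m) (A : 'M[R]_(k, m)) :
  w A = \sum_(f : {ffun 'I_k -> 'I_m}) (\prod_i A i (f i)) * w (rowsub f 1%:M).
Proof. by rewrite -{1}[A]mulmx1 form_mulmx_expand. Qed.

Lemma is_derive_form (k m : nat) (w : exterior_form R k m)
    (B : R -> 'M[R]_(k, m)) (B' : 'M[R]_(k, m)) (t : R) :
  (forall i j, is_derive t 1 (fun s => B s i j) (B' i j)) ->
  is_derive t 1 (fun s => w (B s)) (dform w (B t) B').
Proof.
move=> dB.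
under eq_fun do rewrite form_expand.
have fd (f : {ffun 'I_k -> 'I_m}) := is_derive_bigprod
  (index_enum_uniq 'I_k) (fun i => dB i (f i)).
have fdw (f : {ffun 'I_k -> 'I_m}) : is_derive t 1
    (fun s => (\prod_i B s i (f i)) * w (rowsub f 1%:M))
    (w (rowsub f 1%:M) * \sum_i \prod_j (if j == i then B' j (f j) else B t j (f j))).
  rewrite (_ : (fun _ => _) = w (rowsub f 1%:M) \*: (fun s => \prod_i B s i (f i))).
    exact: (is_deriveZ _ (fd f)).
  by apply/funext => s; rewrite mulrC.
apply: (is_derive_eq (is_derive_bigsum (index_enum _) fdw)).
under eq_bigr do rewrite mulrC big_distrl.
rewrite exchange_big; apply: eq_bigr => i _; rewrite form_expand /=.
apply: eq_bigr => f _; congr (_ * _); apply: eq_bigr => j _.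
by rewrite !mxE; case: eqP => [->|]; rewrite !mxE.
Qed.

End Derive.

Section MatrixContinuity.
Variables (R : realType) (T : topologicalType).

Lemma continuous_mx_coord p q (f : T -> 'M[R]_(p, q)) i j :
  continuous f -> continuous (fun x => f x i j).
Proof.
move=> cf x; apply: (@continuous_comp _ _ _ f (fun A : 'M[R]_(p, q) => A i j)).
  exact: cf.
exact: coord_continuous.
Qed.

Lemma continuous_ext (U : topologicalType) (f g : T -> U) :
  f =1 g -> continuous f -> continuous g.
Proof. by move=> /funext->. Qed.

Lemma continuous_add (f g : T -> R) :
  continuous f -> continuous g -> continuous (fun x => f x + g x).
Proof. by move=> cf cg x; exact: (cvgD (cf x) (cg x)). Qed.

Lemma continuous_mul (f g : T -> R) :
  continuous f -> continuous g -> continuous (fun x => f x * g x).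
Proof. by move=> cf cg x; exact: (cvgM (cf x) (cg x)). Qed.

Lemma continuous_const (U : topologicalType) (a : U) : continuous (fun _ : T => a).
Proof. exact: cst_continuous. Qed.

Lemma continuous_addmx p q (f g : T -> 'M[R]_(p, q)) :
  continuous f -> continuous g -> continuous (fun x => f x + g x).
Proof.
move=> cf cg; apply: mx_continuous => i j.
apply: (continuous_ext (f := fun x => f x i j + g x i j)) => [x|]; first by rewrite mxE.
by apply: continuous_add; exact: continuous_mx_coord.
Qed.

Lemma continuous_scalemx p q (a : T -> R) (f : T -> 'M[R]_(p, q)) :
  continuous a -> continuous f -> continuous (fun x => a x *: f x).
Proof.
move=> ca cf; apply: mx_continuous => i j.
apply: (continuous_ext (f := fun x => a x * f x i j)) => [x|]; first by rewrite mxE.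
by apply: continuous_mul => //; exact: continuous_mx_coord.
Qed.

Lemma continuous_mulmx p q r (f : T -> 'M[R]_(p, q)) (g : T -> 'M[R]_(q, r)) :
  continuous f -> continuous g -> continuous (fun x => f x *m g x).
Proof.
move=> cf cg; apply: mx_continuous => i j.
apply: (continuous_ext (f := fun x => \sum_l f x i l * g x l j)) => [x|].
  by rewrite mxE.
by apply: sum_continuous => l; apply: continuous_mul; exact: continuous_mx_coord.
Qed.

Lemma continuous_trmx p q (f : T -> 'M[R]_(p, q)) :
  continuous f -> continuous (fun x => (f x)^T).
Proof.
move=> cf; apply: mx_continuous => i j.
apply: (continuous_ext (f := fun x => f x j i)) => [x|]; first by rewrite mxE.
exact: continuous_mx_coord.
Qed.

Lemma continuous_row p q (f : T -> 'M[R]_(p, q)) i :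
  continuous f -> continuous (fun x => row i (f x)).
Proof.
move=> cf; apply: mx_continuous => a j.
apply: (continuous_ext (f := fun x => f x i j)) => [x|]; first by rewrite mxE.
exact: continuous_mx_coord.
Qed.

Lemma continuous_setrow p q i (v : T -> 'rV[R]_q) (f : T -> 'M[R]_(p, q)) :
  continuous v -> continuous f -> continuous (fun x => setrow i (v x) (f x)).
Proof.
move=> cv cf; apply: mx_continuous => a j.
apply: (continuous_ext (f := fun x => if a == i then v x 0 j else f x a j)) => [x|].
  by rewrite mxE; case: eqP; rewrite ?mxE.
by case: eqP => _; exact: continuous_mx_coord.
Qed.

Lemma continuous_form p q (w : exterior_form R p q) (f : T -> 'M[R]_(p, q)) :
  continuous f -> continuous (fun x => w (f x)).
Proof. by move=> cf x; exact: (continuous_comp (cf x) (@form_continuous _ _ _ w _)). Qed.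

Lemma continuous_dform p q (w : exterior_form R p q) (f g : T -> 'M[R]_(p, q)) :
  continuous f -> continuous g -> continuous (fun x => dform w (f x) (g x)).
Proof.
move=> cf cg; apply: sum_continuous => i; apply: continuous_form.
by apply: continuous_setrow => //; exact: continuous_row.
Qed.

Lemma continuous_det p (f : T -> 'M[R]_p) :
  continuous f -> continuous (fun x => \det (f x)).
Proof.
move=> cf; apply: sum_continuous => s; apply: continuous_mul.
  exact: continuous_const.
by apply: prod_continuous => i; exact: continuous_mx_coord.
Qed.

Lemma continuous_invmx p (f : T -> 'M[R]_p) : (forall x, f x \in unitmx) ->
  continuous f -> continuous (fun x => invmx (f x)).
Proof.
move=> uf cf.
apply: (continuous_ext (f := fun x => (\det (f x))^-1 *: \adj (f x))) => [x|].
  by rewrite /invmx uf.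
apply: continuous_scalemx.
  move=> x; apply: cvgV; last exact: continuous_det.
  by have := uf x; rewrite unitmxE unitfE.
apply: mx_continuous => i j.
apply: (continuous_ext (f := fun x => cofactor (f x) j i)) => [x|]; first by rewrite mxE.
apply: continuous_mul; first exact: continuous_const.
apply: continuous_det; apply: mx_continuous => a b.
apply: (continuous_ext (f := fun x => f x (lift j a) (lift i b))) => [x|].
  by rewrite !mxE.
exact: continuous_mx_coord.
Qed.

Lemma continuous_gr k m (U : T -> 'M[R]_(k, m)) (W : T -> grassmannian R k m) :
  continuous U -> (forall x, (U x == W x)%MS) -> continuous W.
Proof.
move=> cU UW; apply: (@continuous_comp_initial _ _ _ (@orth_proj R k m)).
apply: (continuous_ext (f := fun x => (U x)^T *m invmx (U x *m (U x)^T) *m U x)) => [x|].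
  exact/esym/orth_projE/UW.
apply: continuous_mulmx => //; apply: continuous_mulmx; first exact: continuous_trmx.
apply: continuous_invmx => [x|].
  by apply: gram_unit; rewrite /row_free (eqmxP (UW x)) gr_rank.
by apply: continuous_mulmx => //; exact: continuous_trmx.
Qed.

Lemma near_sign (f : T -> R) x : continuous f -> 0 < f x -> \forall y \near x, 0 < f y.
Proof.
move=> cf fx; apply: (cf x [set y : R | 0 < y]); by apply: open_nbhs_nbhs; split.
Qed.

Lemma near_neq0 (f : T -> R) x : continuous f -> f x != 0 -> \forall y \near x, f y != 0.
Proof.
move=> cf fx; apply: (cf x [set y : R | y != 0]).
by apply: open_nbhs_nbhs; split=> //; exact: open_neq.
Qed.

End MatrixContinuity.

(** * Curves in the Grassmannian *)

Section Dform.
Variables (R : realType) (k m : nat) (w : exterior_form R k m).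
Implicit Types (U A B : 'M[R]_(k, m)).

Lemma dform_lin U A B b c :
  dform w U (b *: A + c *: B) = b * dform w U A + c * dform w U B.
Proof.
rewrite /dform !mulr_sumr -big_split; apply: eq_bigr => i _ /=.
by rewrite -form_setrow_lin; congr (w (setrow _ _ _)); apply/rowP => j; rewrite !mxE.
Qed.

Lemma is_derive_line U A (t : R) :
  is_derive t 1 (fun s => w (U + s *: A)) (dform w (U + t *: A) A).
Proof.
apply: is_derive_form => i j.
have -> : (fun s => (U + s *: A) i j) = cst (U i j) + A i j \*: (@id R).
  by apply/funext => s; rewrite !mxE mulrC.
have := is_deriveD (is_derive_cst (U i j) t 1) (is_deriveZ (A i j) (is_derive_id t 1)).
by move/is_derive_eq; apply; rewrite add0r scaler1.
Qed.

(** Both sides are the derivative at s = 0 of w(G (U + s A)) = det G w(U + s A). *)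
Lemma dform_mulmx (G : 'M[R]_k) U A :
  dform w (G *m U) (G *m A) = \det G * dform w U A.
Proof.
have d1 := is_derive_line U A 0.
have d2 := is_derive_line (G *m U) (G *m A) 0.
rewrite !scale0r !addr0 in d1 d2.
have d3 : is_derive (0 : R) 1 (fun s => w (G *m U + s *: (G *m A)))
    (\det G * dform w U A).
  rewrite (_ : (fun s => _) = \det G \*: (fun s => w (U + s *: A))).
    exact: is_deriveZ.
  by apply/funext => s; rewrite scalemxAr -mulmxDr form_mulmx.
by rewrite -(@derive_val _ _ _ _ _ _ _ d2) -(@derive_val _ _ _ _ _ _ _ d3).
Qed.

(** Every summand other than the [i]-th keeps row [i] of [U], which lies in the kernel. *)
Lemma dform_row_ker i U A : form_ker w (row i U) ->
  dform w U A = w (setrow i (row i A) U).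
Proof.
move=> kU; rewrite /dform (bigD1 i) //= big1 ?addr0 // => j ji.
by apply: (@form_ker_row _ _ _ _ i); rewrite row_setrow eq_sym (negPf ji).
Qed.

End Dform.

Section MatrixDerivative.
Variable R : realType.

Definition mx_derive (p q : nat) (B : R -> 'M[R]_(p, q)) (t : R) (B' : 'M[R]_(p, q)) :=
  forall i j, is_derive t 1 (fun s => B s i j) (B' i j).

Lemma mx_derive_unique p q (B : R -> 'M[R]_(p, q)) t B1 B2 :
  mx_derive B t B1 -> mx_derive B t B2 -> B1 = B2.
Proof.
move=> d1 d2; apply/matrixP => i j.
by rewrite -(@derive_val _ _ _ _ _ _ _ (d1 i j)) -(@derive_val _ _ _ _ _ _ _ (d2 i j)).
Qed.

Lemma mx_derive_cst p q (B : 'M[R]_(p, q)) t : mx_derive (fun=> B) t 0.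
Proof. by move=> i j; rewrite mxE; exact: is_derive_cst. Qed.

Lemma mx_derive_tr p q (B : R -> 'M[R]_(p, q)) t B' :
  mx_derive B t B' -> mx_derive (fun s => (B s)^T) t B'^T.
Proof.
move=> dB i j; rewrite mxE; have := dB j i.
by congr (is_derive _ _ _ _); apply/funext => s; rewrite mxE.
Qed.

Lemma mx_deriveM p q r (A : R -> 'M[R]_(p, q)) (B : R -> 'M[R]_(q, r)) t A' B' :
  mx_derive A t A' -> mx_derive B t B' ->
  mx_derive (fun s => A s *m B s) t (A' *m B t + A t *m B').
Proof.
move=> dA dB i j.
under eq_fun do rewrite mxE.
have d l := is_deriveM (dA i l) (dB l j).
apply: (is_derive_eq (is_derive_bigsum (index_enum _) d)).
rewrite !mxE -big_split /=; apply: eq_bigr => l _.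
by rewrite [RHS]addrC [X in _ = _ + X]mulrC.
Qed.

Lemma mx_derive_poly p q (U : 'M[{poly R}]_(p, q)) t :
  mx_derive (fun s => map_mx (horner_eval s) U) t (map_mx (horner_eval t \o deriv) U).
Proof.
move=> i j; rewrite mxE /=.
by under eq_fun do rewrite mxE; exact: is_derive_poly.
Qed.

(** The derivative is again a quotient of polynomials, over q^2, which has no zero either; so the
    induction on [l] runs over all p and q. *)
Lemma rational_smooth (p q : {poly R}) (l : nat) (t : R) :
  (forall s, q.[s] != 0) -> derivable (derive1n l (fun s => p.[s] / q.[s])) t 1.
Proof.
move=> q0.
have dpq (a b : {poly R}) s : b.[s] != 0 -> is_derive s 1 (fun s => a.[s] / b.[s])
    ((a^`() * b - a * b^`()).[s] / (b ^+ 2).[s]).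
  move=> b0; have db : is_derive s 1 (fun s => b.[s]^-1) (- b.[s] ^- 2 *: b^`().[s]).
    exact: is_deriveV.
  apply: (is_derive_eq (is_deriveM (is_derive_poly a s) db)).
  rewrite -[LHS]/(a.[s] * (- b.[s] ^- 2 * b^`().[s]) + b.[s]^-1 * a^`().[s]).
  have quot (x y x' y' : R) : y != 0 ->
      x * (- y ^- 2 * y') + y^-1 * x' = (x' * y - x * y') / y ^+ 2 by move=> ?; field.
  by rewrite quot // hornerD hornerN !hornerM.
elim: l p q q0 => [|l IH] p q q0.
  by have [] := dpq p q t (q0 t).
rewrite derive1Sn.
have -> : derive1 (fun s => p.[s] / q.[s]) =
    (fun s => (p^`() * q - p * q^`()).[s] / (q ^+ 2).[s]).
  apply/funext => s; rewrite derive1E; have d := dpq p q s (q0 s).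
  exact: derive_val.
by apply: IH => s; rewrite hornerE expf_neq0.
Qed.

End MatrixDerivative.

Section Curves.
Variables (R : realType) (k m : nat).
Implicit Types (W : grassmannian R k m) (c : R -> grassmannian R k m) (X : 'M[R]_m).

(* By Cramer's rule the entries of the projection are rational functions of t. *)
Lemma polynomial_curve_smooth (U : 'M[{poly R}]_(k, m)) c :
  (forall t, (map_mx (horner_eval t) U == c t)%MS) -> smooth_curve c.
Proof.
move=> Uc i j l t.
pose G := U *m U^T.
have GE s : map_mx (horner_eval s) G =
    map_mx (horner_eval s) U *m (map_mx (horner_eval s) U)^T.
  by rewrite map_mxM /= map_trmx.
have Gu s : map_mx (horner_eval s) G \in unitmx.
  by rewrite GE gram_unit // /row_free (eqmxP (Uc s)) gr_rank.
have detG s : (\det G).[s] != 0.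
  by have := Gu s; rewrite unitmxE unitfE det_map_mx.
have -> : (fun s => orth_proj (c s) i j) =
    (fun s => ((U^T *m \adj G *m U) i j).[s] / (\det G).[s]).
  apply/funext => s; rewrite (orth_projE (Uc s)) -GE /invmx Gu.
  rewrite -[_.[s]]/(horner_eval s _) -[(\det G).[s]]/(horner_eval s _).
  rewrite -scalemxAr -scalemxAl mxE mulrC det_map_mx; congr (_ / _).
  rewrite -map_mx_adj map_trmx -!map_mxM mxE //.
exact: rational_smooth.
Qed.

(** The linearization at Q = [orth_proj W] of the equations Q^T = Q and Q Q = Q. *)
Definition gr_tangent W X : Prop :=
  X^T = X /\ X *m orth_proj W + orth_proj W *m X = X.

Lemma velocity_mx_derive c t : smooth_curve c ->
  mx_derive (fun s => orth_proj (c s)) t (velocity c t).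
Proof.
move=> sc i j; rewrite mxE derive1E; apply: derivableP; exact: (sc i j 0%N t).
Qed.

Lemma velocity_gr_tangent c t : smooth_curve c -> gr_tangent (c t) (velocity c t).
Proof.
move=> sc; have d := velocity_mx_derive t sc; split.
  apply: (mx_derive_unique _ d).
  have := mx_derive_tr d; congr mx_derive; apply/funext => s; exact: orth_proj_sym.
apply: (mx_derive_unique _ d).
have := mx_deriveM d d; congr mx_derive; apply/funext => s; exact: orth_proj_idem.
Qed.

(** In X = X Q + Q X the two summands are transposes of each other, and Q X is determined by U X. A
    tangent vector is thus a linear map from W to its orthogonal complement. *)
Lemma gr_tangent_inj W (U : 'M[R]_(k, m)) X Y : (U == W)%MS ->
  gr_tangent W X -> gr_tangent W Y -> U *m X = U *m Y -> X = Y.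
Proof.
move=> UW [Xs XE] [Ys YE] UXY.
have QXY : orth_proj W *m X = orth_proj W *m Y.
  by rewrite (orth_projE UW) -!mulmxA UXY.
have XQY : X *m orth_proj W = Y *m orth_proj W.
  by apply: trmx_inj; rewrite trmx_mul [RHS]trmx_mul Xs Ys orth_proj_sym.
by rewrite -XE -YE QXY XQY.
Qed.

Lemma gr_tangent_mulmxQ W U X : (U == W)%MS -> gr_tangent W X ->
  U *m X *m orth_proj W = 0 :> 'M[R]_(k, m).
Proof.
move=> UW [Xs XE]; have UQ : U *m orth_proj W = U by apply: orth_proj_id; rewrite (eqmxP UW).
have : U *m (X *m orth_proj W + orth_proj W *m X) = U *m X by rewrite XE.
rewrite mulmxDr (mulmxA U X) (mulmxA U _ X) UQ => /eqP; rewrite -subr_eq0 addrK => /eqP //.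
Qed.

(** Differentiate U Q = U. Only the component of U' orthogonal to the subspace moves the
    subspace. *)
Lemma velocity_basis c t (U : R -> 'M[R]_(k, m)) U' : smooth_curve c ->
  (forall s, (U s <= c s)%MS) -> mx_derive U t U' ->
  U t *m velocity c t = U' - U' *m orth_proj (c t).
Proof.
move=> sc Uc dU; have dc := velocity_mx_derive t sc.
have := mx_deriveM dU dc.
have -> : (fun s => U s *m orth_proj (c s)) = U.
  by apply/funext => s; exact: orth_proj_id.
by move=> /(mx_derive_unique dU) {1}->; rewrite addrC addKr.
Qed.

Lemma polynomial_curve (U : 'M[{poly R}]_(k, m)) :
  (forall t, row_free (map_mx (horner_eval t) U)) ->
  exists c, [/\ smooth_curve c, forall t, (map_mx (horner_eval t) U == c t)%MS &
    forall X, gr_tangent (c 0) X ->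
      map_mx (horner_eval 0) U *m X = map_mx (horner_eval 0 \o deriv) U *m
        (1%:M - orth_proj (c 0)) -> velocity c 0 = X].
Proof.
move=> fU; exists (fun t => Defs.span (fU t)).
have Uc t : (map_mx (horner_eval t) U == Defs.span (fU t))%MS by exact: span_eqmx.
have sc := polynomial_curve_smooth Uc; split=> // X TX UX.
apply: (gr_tangent_inj (Uc 0) (velocity_gr_tangent 0 sc) TX).
rewrite (velocity_basis sc _ (mx_derive_poly U 0)); last first.
  by move=> s; rewrite (eqmxP (Uc s)).
by rewrite UX mulmxBr mulmx1.
Qed.

Lemma gr_tangentP W X : gr_tangent W X <-> tangent setT W X.
Proof.
split=> [TX|[c [sc <- _ <-]]]; last exact: velocity_gr_tangent.
have [U UW] := gr_basis W.
have fU : row_free U by rewrite /row_free (eqmxP UW) gr_rank.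
pose A := U *m X; have AQ : A *m orth_proj W = 0 by exact: gr_tangent_mulmxQ.
pose B : 'M[{poly R}]_(k, m) := map_mx polyC U + 'X *: map_mx polyC A.
have BE t : map_mx (horner_eval t) B = U + t *: A.
  by apply/matrixP => i j; rewrite !mxE /horner_eval !hornerE.
(* The increment A is orthogonal to W, so projecting U + t A onto W gives back the independent rows
   U, for every t. *)
have fB t : row_free (map_mx (horner_eval t) B).
  rewrite BE; apply/row_freeP; have /row_freeP[V UV] := fU.
  exists (orth_proj W *m V); rewrite mulmxA mulmxDl -scalemxAl AQ scaler0 addr0.
  by rewrite orth_proj_id ?(eqmxP UW).
have [c [sc Bc vc]] := polynomial_curve fB.
have c0 : c 0 = W.
  have := Bc 0; rewrite BE scale0r addr0 => Uc0.
  by apply/gr_eqP/eqmxP/(eqmx_trans (eqmx_sym (eqmxP Uc0)) (eqmxP UW)).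
exists c; split => //; first exact: filterT.
apply: vc; rewrite c0 // BE scale0r addr0 mulmxBr mulmx1.
rewrite (_ : map_mx _ B = A) ?AQ ?subr0 //.
by apply/matrixP => i j; rewrite !mxE /= /horner_eval !poly.derivE !hornerE.
Qed.

End Curves.

(** * The tangent space of the train *)

Lemma mulmx_delta (R : comNzRingType) (n m : nat) (g : 'rV[R]_n) (i : 'I_n) (v : 'rV[R]_m) :
  g *m (delta_mx i 0 *m v) = g 0 i *: v.
Proof.
rewrite mulmxA -colE (_ : col i g = (g 0 i)%:M) ?mul_scalar_mx //.
by apply/matrixP => a b; rewrite !mxE !ord1 mulr1n.
Qed.

Section Train.
Variables (R : realType) (n : nat) (P : grassmannian R n (2 * n)).
Variable w1 : exterior_form R n (2 * n).
Hypotheses (n_gt0 : (1 <= n)%N)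
  (ker_w1 : forall v : 'rV[R]_(2 * n), form_ker w1 v <-> (v <= P)%MS).
Implicit Types (W : grassmannian R n (2 * n)) (U : 'M[R]_(n, 2 * n)).

Let K := cokermx P.

Lemma pencil_form_neq0 U : (w1 U != 0) = row_free (U *m K).
Proof. by apply: form_neq0_free => //; rewrite gr_rank mul2n addnn. Qed.

(** Rank-nullity for the quotient map modulo P restricted to W, whose kernel is the intersection of
    W and P. *)
Lemma rank_train W U : (U == W)%MS ->
  (\rank (W :&: P)%MS + \rank (U *m K))%N = n.
Proof.
move=> UW; have := mxrank_mul_ker U K; rewrite (eqmxP UW) gr_rank addnC => e; rewrite -[RHS]e.
congr (_ + _)%N; apply: eqmx_rank; apply/eqmxP.
apply: cap_eqmx; [exact/eqmx_sym/eqmxP|].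
by apply/eqmxP/rV_eqP => v; rewrite submxE; apply/eqP/sub_kermxP.
Qed.

Lemma trainE W U : (U == W)%MS -> train P W <-> w1 U = 0.
Proof.
move=> UW; have := rank_train UW; rewrite /train /= -mxrank_eq0 => r.
have -> : w1 U = 0 <-> ~~ row_free (U *m K) by rewrite -pencil_form_neq0 negbK; split => /eqP.
rewrite /row_free; split; apply: contraNN => /eqP e; move: r; rewrite e.
  by lia.
by lia.
Qed.

Lemma train_form0 W U : train P W -> (U <= W)%MS -> w1 U = 0.
Proof.
move=> tW UW; apply/eqP/negPn/negP => w0.
have := form_row_free w0 => fU.
by move: w0; rewrite (trainE (eqmx_span UW fU)).1 ?eqxx.
Qed.

Lemma train1_train W : train1 P W -> train P W.
Proof. by rewrite /train1 /train /= -mxrank_eq0 => ->. Qed.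

Lemma train1_rank W U : (U == W)%MS -> train1 P W <-> \rank (U *m K) = n.-1.
Proof.
move=> /rank_train r; rewrite /train1 /=; split=> e; lia.
Qed.

Lemma basis_change W U U' : (U == W)%MS -> (U' == W)%MS ->
  exists2 G : 'M[R]_n, \det G != 0 & U' = G *m U.
Proof.
move=> UW UW'; have /submxP[G GE] : (U' <= U)%MS by rewrite (eqmxP UW) (eqmxP UW').
exists G => //; rewrite -unitfE -unitmxE -row_free_unit.
have : row_free U' by rewrite /row_free (eqmxP UW') gr_rank.
rewrite GE -!kermx_eq0 -!submx0 => fU; apply: submx_trans fU.
by apply/sub_kermxP; rewrite mulmxA mulmx_ker mul0mx.
Qed.

(** A dependency g of the rows modulo P with g_i nonzero allows row i to be exchanged for g U, which
    lies in P. *)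
Lemma train1_basis W : train1 P W ->
  exists U i, (U == W)%MS /\ (row i U <= P)%MS.
Proof.
move=> tW; have [U UW] := gr_basis W.
have fUK : ~~ row_free (U *m K).
  by rewrite -pencil_form_neq0 negbK; apply/eqP/(trainE UW)/train1_train.
move: fUK; rewrite -kermx_eq0 => /rowV0Pn[g /sub_kermxP gUK g0].
have /rV0Pn[i gi] := g0.
exists (setrow i (g *m U) U), i; split; last first.
  by rewrite row_setrow_id submxE -mulmxA gUK.
have -> : setrow i (g *m U) U = setrow i g 1%:M *m U by rewrite setrow_mulmx mul1mx.
apply/eqmxP/(eqmx_trans _ (eqmxP UW)); apply: eqmxMfull.
by rewrite row_full_unit unitmxE det_setrow1 unitfE.
Qed.

(** On the smooth part of the train the kernel of U K is a line, and it is spanned by the [i]-th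
    unit vector because row [i] lies in P. *)
Lemma train1_ker W U i (g : 'rV[R]_n) : train1 P W -> (U == W)%MS ->
  (row i U <= P)%MS -> g *m U *m K = 0 -> g 0 i = 0 -> g = 0.
Proof.
move=> tW UW iP gUK gi.
pose e : 'rV[R]_n := delta_mx 0 i.
have eK : (e <= kermx (U *m K))%MS.
  by apply/sub_kermxP; rewrite mulmxA -rowE; apply/eqP; rewrite -submxE.
have gK : (g <= kermx (U *m K))%MS by apply/sub_kermxP; rewrite mulmxA.
have rker : \rank (kermx (U *m K)) = 1%N.
  rewrite mxrank_ker ((train1_rank UW).1 tW). lia.
have re : \rank e = 1%N by rewrite mxrank_delta.
have ke : (kermx (U *m K) <= e)%MS by rewrite -(geq_leqif (mxrank_leqif_sup eK)) rker re.
have /sub_rVP[a ga] := submx_trans gK ke; move: gi; rewrite ga !mxE !eqxx mulr1 => ->.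
by rewrite scale0r.
Qed.

(** U K has rank n - 1 and [K] has rank n, so some vector v lies outside W + P. Putting it in row
    [i], which is zero modulo P, makes the rows independent modulo P. *)
Lemma train1_transversal W U i : train1 P W -> (U == W)%MS -> (row i U <= P)%MS ->
  exists v, w1 (setrow i v U) != 0.
Proof.
move=> tW UW iP.
have rK : \rank K = n by rewrite mxrank_coker gr_rank mul2n -addnn addnK.
have : ~~ (K <= U *m K)%MS.
  apply/negP => /mxrankS; rewrite rK ((train1_rank UW).1 tW).
  lia.
move=> /row_subPn[j]; rewrite rowE; set v := delta_mx 0 j => vU.
exists v; rewrite pencil_form_neq0 setrow_mulmx -kermx_eq0.
apply: contraNT vU => /rowV0Pn[g /sub_kermxP gS g0].
pose h := g - g 0 i *: delta_mx 0 i.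
have hi : h 0 i = 0 by rewrite !mxE !eqxx mulr1 subrr.
have iUK : row i (U *m K) = 0 by rewrite row_mul; apply/eqP; rewrite -submxE.
have hU : h *m U *m K = - (g 0 i *: (v *m K)).
  move: gS; rewrite setrowE iUK subr0 mulmxDr mulmx_delta => /eqP; rewrite addr_eq0 => /eqP e.
  by rewrite /h -mulmxA mulmxBl e -scalemxAl -(rowE i) iUK scaler0 subr0.
have [gi|gi] := eqVneq (g 0 i) 0.
  move: hU; rewrite gi scale0r oppr0 => /(train1_ker tW UW iP)/(_ hi).
  by rewrite /h gi scale0r subr0 => e; rewrite e eqxx in g0.
apply/submxP; exists (- (g 0 i)^-1 *: h).
by rewrite -scalemxAl (mulmxA h) hU scalerN scaleNr opprK scalerA mulVf // scale1r.
Qed.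

Lemma tangent_train1_dform W U X : (U <= W)%MS ->
  tangent (train1 P) W X -> dform w1 U (U *m X) = 0.
Proof.
move=> UW [c [sc c0 cP <-]].
have dU : mx_derive (fun s => U *m orth_proj (c s)) 0 (U *m velocity c 0).
  have := mx_deriveM (mx_derive_cst U 0) (velocity_mx_derive 0 sc).
  by rewrite mul0mx add0r.
have := is_derive_form w1 dU; rewrite c0 orth_proj_id // => d1.
(* The projected basis stays inside the moving subspace, which is in the train, so [w1] vanishes on
   it along the curve. *)
have d0 : is_derive (0 : R) 1 (fun s => w1 (U *m orth_proj (c s))) 0.
  apply: (near_eq_is_derive _ (is_derive_cst (0 : R) (0 : R) (1 : R))).
  apply: filterS cP => s cs; apply/esym/(train_form0 (train1_train cs)).
  exact: orth_proj_sub.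
by rewrite -(@derive_val _ _ _ _ _ _ _ d1) (@derive_val _ _ _ _ _ _ _ d0).
Qed.
(* Choose a basis V of W whose row i lies in P.  Then dform w1 V (V X) = 0 says that
   row i of V X is in P + W, and V can be moved with velocity V X modulo W while
   its row i stays in P. *)
Lemma dform_train1_tangent W U X : train1 P W -> (U == W)%MS ->
  gr_tangent W X -> dform w1 U (U *m X) = 0 -> tangent (train1 P) W X.
Proof.
move=> tW UW TX.
have [V [i [VW iP]]] := train1_basis tW.
have [G G0 ->] := basis_change VW UW; rewrite -mulmxA dform_mulmx.
move=> /eqP; rewrite mulf_eq0 (negPf G0) /=; set A := V *m X.
rewrite (dform_row_ker (i := i)) ?ker_w1 // => /eqP wA.
have AQ : A *m orth_proj W = 0 by exact: gr_tangent_mulmxQ.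
have VQ : V *m orth_proj W = V by apply: orth_proj_id; rewrite (eqmxP VW).
have fV : row_free V by rewrite /row_free (eqmxP VW) gr_rank.
(* A dependency modulo P among the rows of [V] with row [i] replaced by that of [A], scaled to
   coefficient 1 there; [train1_ker] excludes the coefficient 0. *)
have [h hi hP] : exists2 h : 'rV[R]_n, h 0 i = 0 & ((row i A + h *m V)%R <= P)%MS.
  have : ~~ row_free (setrow i (row i A) V *m K) by rewrite -pencil_form_neq0 negbK wA.
  rewrite -kermx_eq0 => /rowV0Pn[g /sub_kermxP gS g0].
  pose h := g - g 0 i *: delta_mx 0 i.
  have hi : h 0 i = 0 by rewrite !mxE !eqxx mulr1 subrr.
  have iVK : row i V *m K = 0 by apply/eqP; rewrite -submxE.
  have gE : g *m setrow i (row i A) V = g 0 i *: row i A + h *m V.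
    rewrite setrowE mulmxDr mulmx_delta scalerBr addrCA; congr (_ + _).
    by rewrite /h mulmxBl -scalemxAl -rowE.
  have gi : g 0 i != 0.
    apply: contra_neq g0 => gi; apply: (train1_ker tW VW iP _ gi).
    by rewrite mulmxA gE gi scale0r add0r /h gi scale0r subr0 in gS.
  exists ((g 0 i)^-1 *: h); first by rewrite mxE hi mulr0.
  rewrite -scalemxAl.
  have : ((g 0 i)^-1 *: (g *m setrow i (row i A) V) <= P)%MS.
    by rewrite scalemx_sub // submxE -mulmxA gS.
  by rewrite gE scalerDr scalerA mulVf // scale1r.
(* Adding [N V] changes the velocity of row [i] only, by a vector of W, and brings it into P. As N^2
   = 0, the matrix 1 + t N has inverse 1 - t N, which keeps the moving rows independent for all
   t. *)
pose N : 'M[R]_n := delta_mx i 0 *m h.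
have NN : N *m N = 0.
  by rewrite /N -mulmxA mulmx_delta hi scale0r mulmx0.
pose B := A + N *m V.
have BQ : B *m orth_proj W = N *m V.
  by rewrite (mulmxDl A (N *m V)) AQ add0r -(mulmxA N) VQ.
pose C : 'M[{poly R}]_(n, 2 * n) := map_mx polyC V + 'X *: map_mx polyC B.
have CE t : map_mx (horner_eval t) C = V + t *: B.
  by apply/matrixP => a b; rewrite !mxE /horner_eval !hornerE.
have fC t : row_free (map_mx (horner_eval t) C).
  rewrite CE; apply/row_freeP; have /row_freeP[V' VV'] := fV.
  exists (orth_proj W *m V' *m (1%:M - t *: N)).
  have -> : (V + t *: B) *m (orth_proj W *m V' *m (1%:M - t *: N)) =
      ((V + t *: B) *m orth_proj W) *m V' *m (1%:M - t *: N).
    by rewrite (mulmxA _ (_ *m V')) (mulmxA (V + _)).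
  have -> : (V + t *: B) *m orth_proj W = (1%:M + t *: N) *m V.
    by rewrite (mulmxDl V) -scalemxAl BQ VQ [RHS]mulmxDl mul1mx -scalemxAl.
  rewrite -(mulmxA _ V) VV' mulmx1.
  rewrite mulmxBr mulmx1 mulmxDl mul1mx -scalemxAl -scalemxAr NN !scaler0 addr0.
  by rewrite addrK.
have [c [sc Cc vc]] := polynomial_curve fC.
have c0 : c 0 = W.
  have := Cc 0; rewrite CE scale0r addr0 => Uc0.
  by apply/gr_eqP/eqmxP/(eqmx_trans (eqmx_sym (eqmxP Uc0)) (eqmxP VW)).
exists c; split => //; last first.
  apply: vc; rewrite c0 // CE scale0r addr0.
  rewrite (_ : map_mx _ C = B).
    by rewrite mulmxBr mulmx1 BQ addrK.
  by apply/matrixP => a b; rewrite !mxE /= /horner_eval !poly.derivE !hornerE.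
(* The moving row [i] stays in P, so the rank modulo P is below n. Near t = 0 putting [v] in that
   row restores rank n, and one row accounts for at most 1, so the rank is exactly n - 1. *)
have [v wv] := train1_transversal tW VW iP.
have cB : continuous (fun t : R => V + t *: B).
  apply: continuous_addmx; first exact: continuous_const.
  by apply: continuous_scalemx; [move=> t; exact: cvg_id|exact: continuous_const].
have cw : continuous (fun t : R => w1 (setrow i v (V + t *: B))).
  by apply/continuous_form/continuous_setrow => //; exact: continuous_const.
have := near_neq0 (x := 0) cw; rewrite scale0r addr0 => /(_ wv).
apply: filterS => t; rewrite pencil_form_neq0 => fS.
have Ct := Cc t; rewrite CE in Ct.
have Ct0 : ~~ row_free ((V + t *: B) *m K).
  rewrite -pencil_form_neq0 negbK (@form_ker_row _ _ _ _ i) //.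
  apply/ker_w1; rewrite linearD /= linearZ /= addmx_sub // scalemx_sub //.
  by rewrite /B linearD /= (rowE _ (N *m V)) /N -mulmxA mulmx_delta mxE !eqxx scale1r.
apply/(train1_rank Ct).
have rle : (\rank ((V + t *: B) *m K) < n)%N.
  by rewrite ltn_neqAle Ct0 rank_leq_row.
move: fS; rewrite setrowE mulmxDl => /eqP rS.
have := mxrank_add ((V + t *: B) *m K) (delta_mx i ord0 *m (v - row i (V + t *: B)) *m K)%R.
have : (\rank (delta_mx i ord0 *m (v - row i (V + t *: B)) *m K)%R <= 1)%N.
  by rewrite -mulmxA mulmx_max_rank.
by rewrite rS; move: n_gt0 rle; move: (\rank _) (\rank _) => a b; clear; lia.
Qed.

End Train.

(** * The co-orientation *)

Section TangentSection.
Variables (R : realType) (k m : nat).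
Implicit Types (W : grassmannian R k m) (X Y : 'M[R]_m).

(* A continuous choice of a tangent vector at each W; it takes the value A at the
   W to which A is tangent. *)
Definition gr_section (A : 'M[R]_m) W : 'M[R]_m :=
  orth_proj W *m A *m (1%:M - orth_proj W) +
  (1%:M - orth_proj W) *m A^T *m orth_proj W.

Lemma gr_section_tangent A W : gr_tangent W (gr_section A W).
Proof.
rewrite /gr_tangent /gr_section.
move: (orth_proj W) (orth_proj_sym W) (orth_proj_idem W) => Q Qs QQ.
have Q1 : Q *m (1%:M - Q) = 0 by rewrite mulmxBr mulmx1 QQ subrr.
have Q2 : (1%:M - Q) *m Q = 0 by rewrite mulmxBl mul1mx QQ subrr.
have Ts : (1%:M - Q)^T = 1%:M - Q by rewrite linearB /= trmx1 Qs.
split.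
  by rewrite linearD /= !trmx_mul Ts Qs trmxK addrC !mulmxA.
rewrite (mulmxDl (Q *m A *m _)) (mulmxDr Q (Q *m A *m _)).
rewrite -(mulmxA (Q *m A)) Q2 -(mulmxA _ Q Q) QQ !(mulmxA Q) QQ Q1.
by rewrite !mul0mx mulmx0 add0r addr0 addrC.
Qed.

Lemma mulmx_gr_section A W (U : 'M[R]_(k, m)) : (U <= W)%MS ->
  U *m gr_section A W = U *m A *m (1%:M - orth_proj W).
Proof.
move=> UW; rewrite /gr_section mulmxDr.
move: (orth_proj W) (orth_proj_id UW) => Q UQ.
by rewrite !mulmxA UQ (mulmxBr U) mulmx1 UQ subrr !mul0mx addr0.
Qed.

Lemma gr_section_id X W : gr_tangent W X -> gr_section X W = X.
Proof.
move=> [Xs XE]; rewrite /gr_section Xs.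
move: (orth_proj W) (orth_proj_idem W) XE => Q QQ XE.
have QXQ : Q *m X *m Q = 0.
  have := congr1 (fun A => Q *m A *m Q) XE.
  rewrite mulmxDr mulmxDl !mulmxA QQ -(mulmxA _ Q Q) QQ => /eqP.
  by rewrite -subr_eq0 addrK => /eqP.
by rewrite mulmxBr mulmx1 !mulmxBl mul1mx QXQ !subr0 addrC.
Qed.

Lemma gr_section_continuous A : continuous (gr_section A).
Proof.
have cQ := @orth_proj_continuous R k m.
have c1 : continuous (fun W => 1%:M - orth_proj W).
  apply: (continuous_ext (f := fun W => 1%:M + (-1) *: orth_proj W)) => [W|].
    by rewrite scaleN1r.
  apply: continuous_addmx; first exact: continuous_const.
  by apply: continuous_scalemx => //; exact: continuous_const.
have cQA : continuous (fun W => orth_proj W *m A *m (1%:M - orth_proj W)).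
  by apply: continuous_mulmx c1; apply: continuous_mulmx cQ _; exact: continuous_const.
have cQA' : continuous (fun W => (1%:M - orth_proj W) *m A^T *m orth_proj W).
  by apply: continuous_mulmx cQ; apply: continuous_mulmx c1 _; exact: continuous_const.
exact: (continuous_addmx cQA cQA').
Qed.

Lemma gr_tangentB W X Y a : gr_tangent W X -> gr_tangent W Y ->
  gr_tangent W (Y - a *: X).
Proof.
move=> [Xs XE] [Ys YE]; split; first by rewrite linearB /= linearZ /= Xs Ys.
rewrite mulmxBl mulmxBr -scalemxAl -scalemxAr -[in RHS]YE -[in RHS]XE scalerDr.
by rewrite opprD addrACA.
Qed.

End TangentSection.

Section Coorientation.
Variables (R : realType) (n : nat) (P : grassmannian R n (2 * n)).
Variables w1 w2 : exterior_form R n (2 * n).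
Hypotheses (n_gt0 : (1 <= n)%N)
  (ker_w1 : forall v : 'rV[R]_(2 * n), form_ker w1 v <-> (v <= P)%MS).
Variable o : bool.
Implicit Types (W : grassmannian R n (2 * n)) (U : 'M[R]_(n, 2 * n)).

(* If [w1 : w2] = [cos x : sin x] along a curve with velocity Y, then on the
   train x' = - (w1)' / w2. *)
Definition turning (U : 'M[R]_(n, 2 * n)) (Y : 'M[R]_(2 * n)) : R :=
  - (-1) ^+ o * (dform w1 U (U *m Y) * w2 U).

Definition positive_side W : set 'M[R]_(2 * n) :=
  [set Y | gr_tangent W Y /\ exists2 U, (U == W)%MS & 0 < turning U Y].

(** A change of basis G multiplies both [dform w1] and [w2] by det G, hence [turning] by a positive
    square: its sign belongs to the subspace. *)
Lemma positive_sideE W U Y : (U == W)%MS ->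
  positive_side W Y <-> gr_tangent W Y /\ 0 < turning U Y.
Proof.
move=> UW; split=> -[TY]; last by split => //; exists U.
move=> [V VW tV]; split=> //; have [G G0 VE] := basis_change UW VW.
move: tV; rewrite VE /turning -mulmxA dform_mulmx form_mulmx (mulrACA (\det G)).
have GG : 0 < \det G * \det G by rewrite -expr2 lt0r sqrf_eq0 G0 sqr_ge0.
by rewrite [X in 0 < X -> _](mulrCA (- _)) pmulr_rgt0.
Qed.

Lemma train_w2_neq0 W U : train P W -> pencil_domain w1 w2 W -> (U == W)%MS ->
  w2 U != 0.
Proof.
move=> tW [V [VW wV]] UW; have [G G0 VE] := basis_change UW VW.
have V0 : w1 V = 0 by apply: (train_form0 n_gt0 ker_w1 tW); rewrite (eqmxP VW).
move: wV; rewrite V0 eqxx => -[//|]; rewrite VE form_mulmx mulf_eq0 negb_or.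
by case/andP.
Qed.

Lemma turning_lin U X Y a : turning U (Y - a *: X) = turning U Y - a * turning U X.
Proof.
rewrite /turning mulmxBr -scalemxAr.
have -> : U *m Y - a *: (U *m X) = 1 *: (U *m Y) + (- a) *: (U *m X).
  by rewrite scale1r scaleNr.
by rewrite dform_lin; ring.
Qed.

Lemma positive_side_nonempty W : train1 P W -> pencil_domain w1 w2 W ->
  exists Y, positive_side W Y.
Proof.
move=> tW MW; have [V [i [VW iP]]] := train1_basis n_gt0 ker_w1 tW.
have [v wv] := train1_transversal n_gt0 ker_w1 tW VW iP.
have w2V := train_w2_neq0 (train1_train tW) MW VW.
have fV : row_free V by rewrite /row_free (eqmxP VW) gr_rank.
have /row_freeP[V' VV'] := fV.
(* With [V'] a right inverse of [V], this [A] moves row [i] of [V] in the direction [v] and fixes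
   the other rows. Its projection away from W does not change [w1], which vanishes on n-tuples in
   W. *)
pose A := V' *m (delta_mx i (ord0 : 'I_1) *m v).
pose Y0 := gr_section A W.
have dY0 : dform w1 V (V *m Y0) != 0.
  rewrite (dform_row_ker (i := i)) ?ker_w1 // mulmx_gr_section ?(eqmxP VW) //.
  have -> : V *m A = delta_mx i ord0 *m v by rewrite /A mulmxA VV' mul1mx.
  rewrite row_mul (rowE _ (_ *m v)) mulmx_delta mxE !eqxx scale1r mulmxBr mulmx1.
  have /submxP[h ->] : (v *m orth_proj W <= V)%MS.
    by rewrite (eqmxP VW) orth_proj_sub.
  rewrite -scaleN1r form_setrowD form_setrowZ form_setrow_comb.
  rewrite (train_form0 n_gt0 ker_w1 (train1_train tW) (U := V)) ?(eqmxP VW) //.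
  by rewrite !mulr0 addr0.
have tY0 : turning V Y0 != 0.
  by rewrite /turning !mulf_neq0 // oppr_eq0 signr_eq0.
(* Scaling by [turning V Y0] itself turns the value into a nonzero square. The shape 0 - a Y0 fits
   [gr_tangentB] and [turning_lin]. *)
exists (0 - (- turning V Y0) *: Y0); apply/(positive_sideE _ VW); split.
  apply: gr_tangentB; first exact: gr_section_tangent.
  by split; rewrite ?trmx0 ?mulmx0 ?mul0mx ?addr0.
rewrite turning_lin mulNr opprK -expr2.
rewrite [X in X + _](_ : _ = 0) ?add0r ?lt0r ?sqrf_eq0 ?tY0 ?sqr_ge0 //.
rewrite /turning mulmx0 (_ : 0 = 0 *: 0 + 0 *: (0 : 'M[R]_(n, 2 * n))); last first.
  by rewrite !scale0r addr0.
by rewrite dform_lin !mul0r addr0 mul0r mulr0.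
Qed.

(** On T_W Gr, [turning U] is a linear functional whose kernel is the tangent space of the train, so
    its positive half-space is the normal ray of any vector in it. The coefficient for Y is the
    ratio of the two values. *)
Lemma positive_side_normal_ray W U X : train1 P W -> (U == W)%MS ->
  gr_tangent W X -> 0 < turning U X -> w2 U != 0 ->
  [/\ tangent setT W X, ~ tangent (train1 P) W X &
      positive_side W = normal_ray (train1 P) W X].
Proof.
move=> tW UW TX tX w2U.
have ntX Y : tangent (train1 P) W Y -> turning U Y = 0.
  move=> /(tangent_train1_dform n_gt0 ker_w1 (U := U)) d0.
  by rewrite /turning d0 ?(eqmxP UW) // mul0r mulr0.
split; first exact/gr_tangentP.
  by move=> /ntX t0; rewrite t0 ltxx in tX.
apply/seteqP; split=> Y.
  move=> /(positive_sideE _ UW)[TY tY]; split; first exact/gr_tangentP.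
  exists (turning U Y / turning U X); first exact: divr_gt0.
  apply: (dform_train1_tangent n_gt0 ker_w1 tW UW); first exact: gr_tangentB.
  have : turning U (Y - (turning U Y / turning U X) *: X) = 0.
    by rewrite turning_lin divfK ?subrr // gt_eqF.
  move=> /eqP; rewrite /turning mulf_eq0 oppr_eq0 signr_eq0 /= mulf_eq0.
  by rewrite (negPf w2U) orbF => /eqP.
move=> [/gr_tangentP TY [a a0 /ntX]]; rewrite turning_lin => /eqP; rewrite subr_eq0 => /eqP tY.
by apply/(positive_sideE _ UW); split => //; rewrite tY mulr_gt0.
Qed.

Lemma continuous_turning (T : topologicalType) (f : T -> 'M[R]_(n, 2 * n))
    (g : T -> 'M[R]_(2 * n)) :
  continuous f -> continuous g -> continuous (fun x => turning (f x) (g x)).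
Proof.
move=> cf cg; apply: continuous_mul; first exact: continuous_const.
apply: continuous_mul; last exact: continuous_form.
by apply: continuous_dform => //; exact: continuous_mulmx.
Qed.

Lemma positive_side_coorientation : coorientation P (pencil_domain w1 w2) positive_side.
Proof.
move=> W0 tW0 MW0; have [Y0 pY0] := positive_side_nonempty tW0 MW0.
have [U0 UW0] := gr_basis W0; have /(positive_sideE _ UW0)[TY0 tY0] := pY0.
(* [B W] is a basis of W on the neighbourhood below: [turning] nonzero forces [w2 (B W)] nonzero,
   hence independent rows. *)
pose B W := U0 *m orth_proj W.
have cB : continuous B.
  by apply: continuous_mulmx; [exact: continuous_const|exact: orth_proj_continuous].
have cX := @gr_section_continuous R n _ Y0.
have cF : continuous (fun W => turning (B W) (gr_section Y0 W)).
  by apply: continuous_turning.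
exists [set W | 0 < turning (B W) (gr_section Y0 W)].
  apply: near_sign cF _; rewrite gr_section_id // /B orth_proj_id //.
  by rewrite (eqmxP UW0).
exists (gr_section Y0); first exact: continuous_subspaceT.
move=> W [/= tX [tW MW]].
have w2B : w2 (B W) != 0.
  by apply: contraTneq tX => e; rewrite /turning e !mulr0 ltxx.
have BW : (B W == W)%MS.
  by apply: eqmx_span; [exact: orth_proj_sub|exact: form_row_free w2B].
by apply: (positive_side_normal_ray tW BW) => //; exact: gr_section_tangent.
Qed.

End Coorientation.

(** * Counting crossings *)

Section Counting.
Variable R : realType.

(** The supremum of the points reached from [a] is itself reached, and the local property there goes
    further unless it equals [b]. *)
Lemma interval_induction (Q : R -> R -> Prop) :
  (forall a b c, a <= b -> b <= c -> Q a b -> Q b c -> Q a c) ->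
  (forall t, exists2 e, 0 < e & forall a b, t - e < a -> a <= b -> b < t + e -> Q a b) ->
  forall a b, a <= b -> Q a b.
Proof.
move=> Qtrans Qloc a b ab.
pose S := [set x | a <= x <= b /\ Q a x].
have Sa : S a.
  split; first by rewrite lexx.
  by have [e e0] := Qloc a; apply; rewrite ?ltrBlDr ?ltrDl.
have supS : has_sup S by split; [exists a|exists b => x [/andP[]]].
have [e e0 He] := Qloc (sup S).
have [x [/andP[ax xb] Qax] ex] := sup_adherent e0 supS.
have xS : x <= sup S by apply: ub_le_sup; [case: supS|split; rewrite ?ax].
pose y := Order.min b (sup S + e / 2).
have xy : x <= y by rewrite le_min xb (le_trans xS) // lerDl divr_ge0 // ltW.
have ye : y < sup S + e.
  by rewrite gt_min; apply/orP; right; rewrite ltrD2l gtr_pMr // invf_lt1 // ltr1n.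
have Sy : S y.
  split; first by rewrite (le_trans ax xy) ge_min lexx.
  by apply: (Qtrans _ _ _ ax xy Qax); apply: He.
have : y <= sup S by apply: ub_le_sup => //; case: supS.
have [_ Qy] := Sy; move: Qy; rewrite /y minEle; case: ifP => // _ _.
by rewrite gerDl leNgt divr_gt0.
Qed.

Variables (h : R -> R) (sg : R -> int).
Hypotheses (ch : continuous h) (sgE : forall t, sg t = 1 \/ sg t = -1).
Hypothesis sgP : forall t, h t \is a Num.int ->
  \forall s \near t, s != t -> 0 < (sg t)%:~R * (h s - h t) * (s - t).

Definition crossings (a b : R) : set R :=
  [set t | a <= t < b /\ h t \is a Num.int].

(* The limit from the left of the floor of h: with this convention a crossing at
   the left end of [a, b[ is counted and one at the right end is not. *)
Definition left_floor (t : R) : int :=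
  Num.floor (h t) - ((h t \is a Num.int) && (sg t == 1))%:R.

Lemma floor_between (k : int) (x : R) : k%:~R < x < (k + 1)%:~R ->
  Num.floor x = k /\ x \isn't a Num.int.
Proof.
move=> /andP[kx xk]; split; first by apply: floor_def; rewrite ltW.
apply/negP => /intrP[z xz]; move: kx xk; rewrite xz !ltr_int; lia.
Qed.

Lemma left_floor_between (k : int) (t : R) : k%:~R < h t < (k + 1)%:~R ->
  left_floor t = k /\ h t \isn't a Num.int.
Proof.
by move=> /floor_between[fk nk]; rewrite /left_floor (negPf nk) fk subr0.
Qed.

Lemma near_between (t a b : R) : a < h t < b -> \forall s \near t, a < h s < b.
Proof.
move=> /andP[l r].
have Fl : \forall s \near t, a < h s by exact: (cvgr_gt _ (@ch t)).
have Fr : \forall s \near t, h s < b by exact: (cvgr_lt _ (@ch t)).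
by apply: filterS2 Fl Fr => s -> ->.
Qed.

(** When h rises through k, [left_floor] is k - 1 up to and including [t] and k just after; when h
    falls through k, it is k up to [t] and k - 1 after. The jump is [sg t] in both cases. *)
Lemma left_floor_local (t : R) : exists2 e, 0 < e &
  (forall s, t - e < s < t -> left_floor s = left_floor t /\ h s \isn't a Num.int) /\
  (forall s, t < s < t + e ->
     left_floor s = left_floor t + (if h t \is a Num.int then sg t else 0) /\
     h s \isn't a Num.int).
Proof.
have [hi|hi] := boolP (h t \is a Num.int); last first.
  have ft : (Num.floor (h t))%:~R < h t < (Num.floor (h t) + 1)%:~R.
    rewrite lt_neqAle floor_le floorD1_gt !andbT.
    by apply: contra hi => /eqP <-; rewrite intr_int.
  have [ftE _] := left_floor_between ft.
  have : \forall s \near t, (Num.floor (h t))%:~R < h s < (Num.floor (h t) + 1)%:~R.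
    exact: near_between.
  move=> /nbhs_ballP[e /= e0 He]; exists e => //; split=> s /andP[s1 s2].
    have /He/left_floor_between : ball t e s.
      by rewrite /ball /= gtr0_norm ?subr_gt0 // ltrBlDr -ltrBlDl.
    by rewrite ftE.
  have /He/left_floor_between : ball t e s.
    by rewrite /ball /= distrC gtr0_norm ?subr_gt0 // ltrBlDl.
  by rewrite ftE addr0.
have [k hk] := intrP hi.
have fk : left_floor t = k - (sg t == 1)%:R by rewrite /left_floor hi hk intrKfloor.
have : \forall s \near t, (s != t -> 0 < (sg t)%:~R * (h s - h t) * (s - t)) /\
    (k - 1)%:~R < h s < (k + 1)%:~R.
  apply: filterS2 (sgP hi) (near_between (a := (k - 1)%:~R) (b := (k + 1)%:~R) _) => //.
  by rewrite hk !ltr_int; apply/andP; split; lia.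
move=> /nbhs_ballP[e /= e0 He]; exists e => //; split=> s /andP[s1 s2].
  have /He[] : ball t e s by rewrite /ball /= gtr0_norm ?subr_gt0 // ltrBlDr -ltrBlDl.
  rewrite lt_eqF // => /(_ isT); rewrite nmulr_lgt0 ?subr_lt0 // hk fk.
  case: (sgE t) => -> /= + /andP[l r].
    rewrite mul1r subr_lt0 => hs; apply: left_floor_between.
    by rewrite l subrK.
  rewrite mulN1r oppr_lt0 subr_gt0 subr0 => hs; apply: left_floor_between.
  by rewrite hs.
have /He[] : ball t e s by rewrite /ball /= distrC gtr0_norm ?subr_gt0 // ltrBlDl.
rewrite gt_eqF // => /(_ isT); rewrite pmulr_lgt0 ?subr_gt0 // hk fk.
case: (sgE t) => -> /= + /andP[l r].
  rewrite mul1r subr_gt0 subrK => hs; apply: left_floor_between.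
  by rewrite hs.
rewrite mulN1r oppr_gt0 subr_lt0 subr0 => hs; apply: left_floor_between.
by rewrite l subrK.
Qed.

(** Both sides are additive over adjacent half-open intervals, so it suffices to treat intervals so
    close to a point t that only t can be a crossing. *)
Lemma crossing_count (a b : R) : a <= b ->
  finite_set (crossings a b) /\
  \sum_(t \in crossings a b) sg t = left_floor b - left_floor a.
Proof.
apply: (interval_induction (Q := fun a b => finite_set (crossings a b) /\
  \sum_(t \in crossings a b) sg t = left_floor b - left_floor a)) => {a b}.
  move=> a b c ab bc [fab sab] [fbc sbc].
  have -> : crossings a c = crossings a b `|` crossings b c.
    apply/seteqP; split=> t.
      move=> [/andP[at_ tc] it]; have [tb|bt] := ltP t b; [left|right]; split => //.
        by rewrite at_.
      by rewrite bt.
    move=> [] [/andP[h1 h2] it]; split=> //.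
      by rewrite h1 (lt_le_trans h2).
    by rewrite (le_trans ab).
  split; first by rewrite finite_setU.
  rewrite fsbigU // ?sab ?sbc; last first.
    by move=> t [[/andP[_ tb] _] [/andP[bt _] _]]; move: (lt_le_trans tb bt); rewrite ltxx.
  by rewrite [LHS]addrC subrKA.
move=> t; have [e e0 [lt rt]] := left_floor_local t; exists e => // a b ta ab bt.
have none : (forall s, a <= s < b -> s != t) ->
    finite_set (crossings a b) /\ \sum_(s \in crossings a b) sg s = 0.
  move=> nt; have -> : crossings a b = set0.
    apply/seteqP; split=> // s [/[dup] sab /nt st is_].
    case/andP: sab => as_ sb.
    case: (ltgtP s t) st => // st _.
      by have [|_ /negP[]] := lt s; rewrite // st (lt_le_trans ta).
    by have [|_ /negP[]] := rt s; rewrite // st (lt_trans sb).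
  by split; [exact: finite_set0|rewrite fsbig_set0].
(* The interval lies to the right of t, or ends at or before t, or contains t; only in the last case
   can there be a crossing. *)
have [ta'|at'] := ltP t a.
  have [|fab ->] := none.
    by move=> s /andP[as_ _]; rewrite gt_eqF // (lt_le_trans ta').
  split => //; rewrite (rt a _).1 ?ta' ?(le_lt_trans ab) // (rt b _).1 ?subrr //.
  by rewrite bt (lt_le_trans ta').
have [tb|bt'] := ltP t b; last first.
  have [|fab ->] := none.
    by move=> s /andP[_ sb]; rewrite lt_eqF // (lt_le_trans sb).
  split => //; have lE s : t - e < s -> s <= t -> left_floor s = left_floor t.
    by rewrite le_eqVlt => ts /predU1P[->//|st]; rewrite (lt s _).1 ?ts.
  by rewrite !lE ?subrr // (lt_le_trans ta).
have aE : left_floor a = left_floor t.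
  by move: at'; rewrite le_eqVlt => /predU1P[->//|a_t]; rewrite (lt a _).1 ?ta.
rewrite aE (rt b _).1 ?tb // addrC addKr.
have [ti|ti] := boolP (h t \is a Num.int).
  have -> : crossings a b = [set t].
    apply/seteqP; split=> [s [/andP[as_ sb] is_]|s ->]; last by rewrite /crossings /= at' tb.
    rewrite /=; case: (ltgtP s t) => // st.
      by have [|_ /negP[]] := lt s; rewrite // st (lt_le_trans ta).
    by have [|_ /negP[]] := rt s; rewrite // st (lt_trans sb).
  by split; [exact: finite_set1|rewrite fsbig_set1].
have -> : crossings a b = set0.
  apply/seteqP; split=> // s [/andP[as_ sb] is_].
  case: (ltgtP s t) => st.
  - by have [|_ /negP[]] := lt s; rewrite // st (lt_le_trans ta).
  - by have [|_ /negP[]] := rt s; rewrite // st (lt_trans sb).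
  - by rewrite st (negPf ti) in is_.
by split; [exact: finite_set0|rewrite fsbig_set0].
Qed.

End Counting.

(** * Angles and lifts *)

Section Angles.
Variable R : realType.
Implicit Types (x y : R) (W : RP1 R).

Lemma sin_gt0_pi x : 0 < x < pi -> 0 < sin x.
Proof.
move=> /andP[x0 xpi]; case: (ltgtP x (pi / 2)) => [xh|xh|->].
- by apply: sin_gt0_pihalf; rewrite x0.
- have -> : sin x = sin (pi - x) by rewrite sinB sinpi cospi mul0r mulN1r sub0r opprK.
  apply: sin_gt0_pihalf; rewrite subr_gt0 xpi ltrBlDr -ltrBlDl.
  by rewrite [X in X - _]splitr addrK.
- by rewrite sin_pihalf.
Qed.

Lemma sinDnpi x (k : nat) : sin (x + pi *+ k) = (-1) ^+ k * sin x.
Proof.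
elim: k => [|k IH]; first by rewrite addr0 mul1r.
by rewrite mulrSr addrA sinDpi IH exprS mulN1r mulNr.
Qed.

(** Up to sign only the fractional part matters, and the sine is positive on ]0, pi[. *)
Lemma sin_pi_int x : sin (pi * x) = 0 <-> x \is a Num.int.
Proof.
have sinZ (z : int) y : sin (pi * z%:~R + y) = 0 <-> sin y = 0.
  case: z => k.
    rewrite -pmulrn mulr_natr addrC sinDnpi.
    by split=> [/eqP|->]; rewrite ?mulr0 // mulf_eq0 signr_eq0 => /eqP.
  have := sinDnpi (pi * (Negz k)%:~R + y) k.+1.
  rewrite NegzE mulrNz -pmulrn mulrN mulr_natr addrAC addNr add0r => ->.
  by split=> [->|/eqP]; rewrite ?mulr0 // mulf_eq0 signr_eq0 => /eqP.
split=> [s0|/intrP[z ->]]; last by rewrite -[_ * _]addr0; apply/sinZ/sin0.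
set y := pi * (x - (Num.floor x)%:~R).
have /(sinZ _ y) sy : sin (pi * (Num.floor x)%:~R + y) = 0.
  by rewrite /y -mulrDr addrC subrK.
have y0 : 0 <= x - (Num.floor x)%:~R by rewrite subr_ge0 floor_le.
have y1 : x - (Num.floor x)%:~R < 1 by rewrite ltrBlDr addrC -intrD1 floorD1_gt.
move: y0; rewrite le_eqVlt => /predU1P[|y0].
  by move=> /esym/eqP; rewrite subr_eq0 => /eqP ->; exact: intr_int.
have : 0 < sin y by apply: sin_gt0_pi; rewrite mulr_gt0 ?pi_gt0 //= gtr_pMr ?pi_gt0.
by rewrite sy ltxx.
Qed.

Lemma hpoint_eq (a b c d : R) (h : a != 0 \/ b != 0) (h' : c != 0 \/ d != 0) :
  hpoint h = hpoint h' <-> a * d = b * c.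
Proof.
have row2Z (e a' b' : R) : row2 (e * a') (e * b') = e *: row2 a' b'.
  by apply/rowP => i; rewrite !mxE; case: ifP.
split=> [e|e].
  have /sub_rVP[k] : (row2 a b <= row2 c d)%MS.
    have : (row2 a b <= hpoint h)%MS by rewrite /= genmxE.
    by rewrite e /= genmxE.
  rewrite -row2Z => /rowP r; have := r 0; have := r 1; rewrite !mxE /= => -> ->.
  by rewrite mulrAC.
apply/gr_eqP/eqmxP => /=; apply: (eqmx_trans (genmxE _)).
apply: eqmx_sym; apply: (eqmx_trans (genmxE _)); apply: eqmx_sym.
have [c0|c0] := eqVneq c 0.
  have d0 : d != 0 by case: h' => //; rewrite c0 eqxx.
  have a0 : a = 0 by apply: (mulIf d0); rewrite e c0 mulr0 mul0r.
  have b0 : b != 0 by case: h => //; rewrite a0 eqxx.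
  have -> : row2 a b = (b / d) *: row2 c d by rewrite -row2Z c0 a0 mulr0 divfK.
  by apply: eqmx_scale; rewrite mulf_neq0 ?invr_eq0.
have bE : b = (a / c) * d by rewrite mulrAC e mulfK.
have a0 : a != 0.
  by case: h => //; apply: contra_neq => a0; rewrite bE a0 !mul0r.
have -> : row2 a b = (a / c) *: row2 c d by rewrite -row2Z -bE divfK.
by apply: eqmx_scale; rewrite mulf_neq0 ?invr_eq0.
Qed.

Lemma rp1_angle_eq x y : rp1_angle x = rp1_angle y <-> (x - y) / pi \is a Num.int.
Proof.
have pi0 : pi != 0 :> R by rewrite gt_eqF ?pi_gt0.
rewrite -sin_pi_int mulrCA mulfV // mulr1 hpoint_eq sinB.
by split=> [->|/eqP]; rewrite ?subrr // subr_eq0 => /eqP ->.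
Qed.

Lemma rp1_angle_surj W : exists x, rp1_angle x = W.
Proof.
have [U UW] := gr_basis W.
pose a := U 0 0; pose b := U 0 1.
have UE : U = row2 a b.
  apply/rowP => i; rewrite mxE; case: eqVneq => [->//|i0]; congr (U _ _).
  by apply/val_inj => /=; have := ltn_ord i; move: i0; rewrite -val_eqE /=; lia.
have fU : row_free U by rewrite /row_free (eqmxP UW) gr_rank.
have ab : a != 0 \/ b != 0.
  apply/orP; rewrite -negb_and; apply: contraTN fU => /andP[/eqP a0 /eqP b0].
  rewrite UE a0 b0 /row_free (_ : row2 0 0 = 0) ?mxrank0 //.
  by apply/rowP => i; rewrite !mxE; case: ifP.
have WE : W = hpoint ab.
  apply/gr_eqP/eqmxP/(eqmx_trans (eqmx_sym (eqmxP UW))).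
  by rewrite UE /=; exact/eqmx_sym/genmxE.
pose r := Num.sqrt (a ^+ 2 + b ^+ 2).
have r2 : r ^+ 2 = a ^+ 2 + b ^+ 2 by rewrite sqr_sqrtr // addr_ge0 ?sqr_ge0.
have r0 : r != 0.
  by rewrite -sqrf_eq0 r2 paddr_eq0 ?sqr_ge0 // !sqrf_eq0; case: (ab) => /negPf->; rewrite ?andbF.
have cs : (a / r) ^+ 2 + (b / r) ^+ 2 = 1 by rewrite !expr_div_n -mulrDl -r2 divff // expf_neq0.
have c1 : -1 <= a / r <= 1.
  rewrite -ler_norml -(@ler_pXn2r _ 2) ?nnegrE // real_normK ?num_real // expr1n -cs.
  by rewrite lerDl sqr_ge0.
have sE : Num.sqrt (1 - (a / r) ^+ 2) = `|b / r|.
  by rewrite -cs [X in X - _]addrC addrK sqrtr_sqr.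
have cE : cos (acos (a / r)) = a / r by rewrite acosK // in_itv.
rewrite WE; have [b0|b0] := leP 0 (b / r).
  exists (acos (a / r)); apply/hpoint_eq; rewrite cE sin_acos // sE ger0_norm //.
  by field.
exists (- acos (a / r)); apply/hpoint_eq.
by rewrite cosN sinN cE sin_acos // sE ltr0_norm // opprK; field.
Qed.

End Angles.

Section Lifting.
Variable R : realType.
Implicit Types (x y : R) (W : RP1 R).

(* The double-angle coordinates, which embed RP^1 in the unit circle. *)
Definition rp1_cos W : R := orth_proj W 0 0 *+ 2 - 1.
Definition rp1_sin W : R := orth_proj W 0 1 *+ 2.

Lemma rp1_cosE x : rp1_cos (rp1_angle x) = cos (x *+ 2).
Proof.
by rewrite /rp1_cos orth_proj_hpoint cos2Dsin2 divr1 !mxE /= cos_mulr2n expr2.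
Qed.

Lemma rp1_sinE x : rp1_sin (rp1_angle x) = sin (x *+ 2).
Proof. by rewrite /rp1_sin orth_proj_hpoint cos2Dsin2 divr1 !mxE /= sin_mulr2n. Qed.

Definition rp1_dot W W' : R := rp1_cos W * rp1_cos W' + rp1_sin W * rp1_sin W'.
Definition rp1_cross W W' : R := rp1_cos W * rp1_sin W' - rp1_sin W * rp1_cos W'.

(** cross / dot is the tangent of twice the angle from [W] to [W'], whence the division by 2. *)
Definition rp1_increment W W' : R := atan (rp1_cross W W' / rp1_dot W W') / 2.

Lemma rp1_dotxx W : rp1_dot W W = 1.
Proof.
by have [x <-] := rp1_angle_surj W; rewrite /rp1_dot rp1_cosE rp1_sinE -!expr2 cos2Dsin2.
Qed.

Lemma rp1_increment_angle x W : 0 < rp1_dot (rp1_angle x) W ->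
  rp1_angle (x + rp1_increment (rp1_angle x) W) = W.
Proof.
have [y <-] := rp1_angle_surj W; rewrite /rp1_increment.
pose d := y *+ 2 - x *+ 2.
have -> : rp1_dot (rp1_angle x) (rp1_angle y) = cos d.
  by rewrite /rp1_dot !rp1_cosE !rp1_sinE /d cosB mulrC [X in _ + X]mulrC.
have -> : rp1_cross (rp1_angle x) (rp1_angle y) = sin d.
  rewrite /rp1_cross !rp1_cosE !rp1_sinE /d sinB mulrC [X in _ - X]mulrC.
  by rewrite [cos (y *+ 2) * _]mulrC.
move=> cd; pose a := atan (sin d / cos d); rewrite -/a.
have ca : 0 < cos a by apply: cos_gt0_pihalf; rewrite atan_gtNpi2 atan_ltpi2.
have tana : sin a / cos a = sin d / cos d by rewrite -[LHS]/(tan a) atanK.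
have sa : sin a = cos a * sin d / cos d by rewrite -mulrA -tana mulrC divfK // gt_eqF.
have cad : cos (a - d) = cos a / cos d.
  rewrite cosB sa; have := cos2Dsin2 d => e.
  have -> : cos a * cos d + cos a * sin d / cos d * sin d =
      cos a / cos d * (cos d ^+ 2 + sin d ^+ 2) by field; rewrite gt_eqF.
  by rewrite e mulr1.
have sad : sin (a - d) = 0 by rewrite sinB sa; field; rewrite gt_eqF.
(* The sign is what matters: with cosine -1 the half-difference would be an odd multiple of pi / 2,
   giving the orthogonal line. *)
have cad1 : cos (a - d) = 1.
  have : `|cos (a - d)| = 1 by apply: sin0cos1.
  by rewrite ger0_norm // cad divr_ge0 // ltW.
have half (u v w : R) : u + w / 2 - v = (w - (v *+ 2 - u *+ 2)) / 2 by field.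
apply/rp1_angle_eq/sin_pi_int.
have -> : pi * ((x + a / 2 - y) / pi) = (a - d) / 2.
  by rewrite mulrCA mulfV ?mulr1 /d ?gt_eqF ?pi_gt0 // half.
have := cos_mulr2n ((a - d) / 2); rewrite -[X in cos X]mulr_natr divfK ?pnatr_eq0 // cad1.
rewrite cos2sin2 => e; apply/eqP; rewrite -sqrf_eq0; apply/eqP; lra.
Qed.

Lemma rp1_cos_continuous : continuous rp1_cos.
Proof.
have cQ := @continuous_mx_coord R _ 2 2 _ 0 0 (@orth_proj_continuous R 1 2).
apply: (continuous_ext (f := fun W => orth_proj W 0 0 * 2 + (- 1))) => [W|].
  by rewrite mulr_natr.
apply: continuous_add; last exact: continuous_const.
by apply: continuous_mul cQ _; exact: continuous_const.
Qed.

Lemma rp1_sin_continuous : continuous rp1_sin.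
Proof.
have cQ := @continuous_mx_coord R _ 2 2 _ 0 1 (@orth_proj_continuous R 1 2).
apply: (continuous_ext (f := fun W => orth_proj W 0 1 * 2)) => [W|].
  by rewrite mulr_natr.
by apply: continuous_mul cQ _; exact: continuous_const.
Qed.

Section Chain.
Variables (T : topologicalType) (f g : T -> RP1 R).
Hypotheses (cf : continuous f) (cg : continuous g).

Lemma continuous_rp1_cos (h : T -> RP1 R) :
  continuous h -> continuous (fun x : T => rp1_cos (h x)).
Proof. by move=> ch x; exact: (continuous_comp (ch x) (@rp1_cos_continuous _)). Qed.

Lemma continuous_rp1_sin (h : T -> RP1 R) :
  continuous h -> continuous (fun x : T => rp1_sin (h x)).
Proof. by move=> ch x; exact: (continuous_comp (ch x) (@rp1_sin_continuous _)). Qed.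

Lemma continuous_rp1_dot : continuous (fun x : T => rp1_dot (f x) (g x)).
Proof.
by apply: continuous_add; apply: continuous_mul;
  first [exact: continuous_rp1_cos|exact: continuous_rp1_sin].
Qed.

Lemma continuous_rp1_increment : (forall x : T, 0 < rp1_dot (f x) (g x)) ->
  continuous (fun x : T => rp1_increment (f x) (g x)).
Proof.
move=> d0.
have ccr : continuous (fun x : T => rp1_cross (f x) (g x)).
  apply: (continuous_ext (f := fun x : T => rp1_cos (f x) * rp1_sin (g x) +
    (- 1) * (rp1_sin (f x) * rp1_cos (g x)))) => [x|]; first by rewrite mulN1r.
  apply: continuous_add; apply: continuous_mul.
  - exact: continuous_rp1_cos.
  - exact: continuous_rp1_sin.
  - exact: continuous_const.
  - by apply: continuous_mul; [exact: continuous_rp1_sin|exact: continuous_rp1_cos].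
apply: continuous_mul; last exact: continuous_const.
have cq : continuous (fun x : T => rp1_cross (f x) (g x) / rp1_dot (f x) (g x)).
  apply: continuous_mul => // x; apply: cvgV; first by rewrite gt_eqF.
  exact: continuous_rp1_dot.
by move=> x; exact: (continuous_comp (cq x) (@continuous_atan R _)).
Qed.

End Chain.

(* The lift is the sum of the increments of angle along the chain, which are
   continuous since consecutive lines make an angle less than pi / 4. *)
Lemma chain_lift (T : topologicalType) (f : nat -> T -> RP1 R) (N : nat) (x0 : T) :
  (forall j, continuous (f j)) -> (forall x : T, f 0%N x = f 0%N x0) ->
  (forall j (x : T), 0 < rp1_dot (f j x) (f j.+1 x)) ->
  exists2 theta : T -> R, continuous theta & forall x : T, f N x = rp1_angle (theta x).
Proof.
move=> cf f0 fd; elim: N => [|N [theta ctheta fE]].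
  have [a aE] := rp1_angle_surj (f 0%N x0).
  by exists (fun=> a) => [|x]; [exact: continuous_const|rewrite f0].
exists (fun x : T => theta x + rp1_increment (f N x) (f N.+1 x)) => [|x].
  by apply: continuous_add => //; exact: continuous_rp1_increment.
by rewrite fE rp1_increment_angle // -fE.
Qed.

End Lifting.

Section Clamp.
Variable R : realType.

Definition clamp01 (t : R) : R := Order.max 0 (Order.min 1 t).

Lemma clamp01_id t : 0 <= t <= 1 -> clamp01 t = t.
Proof. by move=> /andP[t0 t1]; rewrite /clamp01 min_r // max_r. Qed.

Lemma clamp01_le0 t : t <= 0 -> clamp01 t = 0.
Proof. by move=> t0; rewrite /clamp01 min_r ?(le_trans t0) // max_l. Qed.

Lemma clamp01_ge1 t : 1 <= t -> clamp01 t = 1.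
Proof. by move=> t1; rewrite /clamp01 min_l // max_r. Qed.

Lemma clamp01_itv t : 0 <= clamp01 t <= 1.
Proof. by rewrite le_max lexx /= ge_max ler01 ge_min lexx. Qed.

Lemma clamp01_ge0E t : 0 <= t -> clamp01 t = if 1 <= t then 1 else t.
Proof. by move=> t0; rewrite /clamp01 max_r ?le_min ?ler01 // minEle. Qed.

Lemma clamp01_continuous : continuous clamp01.
Proof.
move=> t; apply: continuous_max; first exact: cst_continuous.
by apply: continuous_min; [exact: cst_continuous|exact: cvg_id].
Qed.

End Clamp.

(** * Lifting maps from a simplex to RP^1 *)

Section SimplexLift.
Variables (R : realType) (k : nat).
Local Notation Delta := (set_type (@simplex R k)).

Lemma simplex_le1 (y : Delta) i : 0 <= val y 0 i <= 1.
Proof.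
have [/= y0 y1] := set_valP y; rewrite y0 /= -y1 (bigD1 i) //= lerDl.
by apply: sumr_ge0.
Qed.

Lemma simplex_compact : compact (@simplex R k).
Proof.
apply: (@subclosed_compact _ _ [set v : 'rV[R]_k.+1 | forall i, `[0, 1]%classic (v ord0 i)]).
- have -> : @simplex R k = (\bigcap_i [set x : 'rV[R]_k.+1 | 0 <= x 0 i]) `&`
      [set x | \sum_i x 0 i = 1].
    apply/seteqP; split=> x [x0 x1]; split => // i; first by move=> _; exact: x0.
    exact: (x0 i I).
  apply: closedI.
    apply: closed_bigI => i _.
    apply: (@preimage_closed _ _ (fun x : 'rV[R]_k.+1 => x 0 i) [set t | 0 <= t]).
      by move=> x _; exact: coord_continuous.
    exact: closed_ge.
  apply: (@preimage_closed _ _ (fun x : 'rV[R]_k.+1 => \sum_i x 0 i) [set t | t = 1]).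
    move=> x _; apply: (@sum_continuous R 'rV[R]_k.+1 _ _ (fun i x => x 0 i)) => i.
    exact: coord_continuous.
  exact: closed_eq.
- apply: (@rV_compact _ _ (fun=> `[0, 1]%classic : set R)) => i; exact: segment_compact.
- by move=> x sx i; have := simplex_le1 (exist _ x (mem_set sx)) i; rewrite /= in_itv.
Qed.

Lemma set_val_nbhs (z : Delta) (A : set Delta) : nbhs z A ->
  exists2 e, 0 < e & forall y : Delta, ball (val z) e (val y) -> A y.
Proof.
move=> [B [[C oC <-] /= Cz] CA].
have /nbhs_ballP[e /= e0 eC] : nbhs (val z) C by apply: open_nbhs_nbhs; split.
by exists e => // y /eC Cy; exact: CA.
Qed.

(** A Lebesgue number: the dot product is 1 on the diagonal, hence positive near it, and compactness
    makes the scale uniform. *)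
Lemma simplex_mesh (f : Delta -> RP1 R) : continuous f ->
  exists N : nat, forall y y' : Delta,
    ball (val y) (N.+1%:R^-1) (val y') -> 0 < rp1_dot (f y) (f y').
Proof.
move=> cf.
have := simplex_compact => /compact_near_coveringP.
pose Q (N : nat) (x : 'rV[R]_k.+1) := forall y y' : Delta,
  ball x (N.+1%:R^-1) (val y) -> ball x (N.+1%:R^-1) (val y') -> 0 < rp1_dot (f y) (f y').
move=> /(_ nat \oo Q _); case.
  move=> x sx; pose z : Delta := exist _ x (mem_set sx).
  have cdot : continuous (fun p : Delta * Delta => rp1_dot (f p.1) (f p.2)).
    apply: continuous_rp1_dot => p.
      exact: (continuous_comp (@cvg_fst _ _ _ _ _) (cf _)).
    exact: (continuous_comp (@cvg_snd _ _ _ _ _) (cf _)).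
  have := near_sign (x := (z, z)) cdot; rewrite /= rp1_dotxx => /(_ ltr01).
  case=> -[A B] /= [/set_val_nbhs[e e0 eA] /set_val_nbhs[e' e0' eB]] AB.
  pose d := Order.min e e'.
  have d0 : 0 < d by rewrite lt_min e0.
  have d2 : 0 < d / 2 by rewrite divr_gt0.
  near=> x' N => /= y y' xy xy'.
  have half (u : Delta) : ball x' (N.+1%:R^-1) (val u) -> ball x d (val u).
    move=> xu; rewrite (splitr d); apply: (@ball_triangle _ _ x').
      by near: x'; exact: nbhsx_ballx.
    apply: le_ball xu; apply: ltW; near: N; exact: (near_infty_natSinv_lt (PosNum d2)).
  apply: (AB (y, y')); split => /=.
    by apply/eA/(le_ball _ (half y xy)); rewrite ge_min lexx.
  by apply/eB/(le_ball _ (half y' xy')); rewrite ge_min lexx orbT.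
move=> N _ /(_ N (leqnn N)) HN; exists N => y y' yy'; apply: (HN _ (set_valP y)) => //.
by apply: ballxx; rewrite invr_gt0 ltr0n.
Unshelve. all: by end_near.
Qed.

Definition vertex0 : 'rV[R]_k.+1 := delta_mx 0 0.

Definition contract_mx (c : R) (y : Delta) : 'rV[R]_k.+1 :=
  (1 - clamp01 c) *: vertex0 + clamp01 c *: val y.

Lemma contract_subproof (c : R) (y : Delta) : contract_mx c y \in @simplex R k.
Proof.
rewrite /contract_mx; have := clamp01_itv c; move: (clamp01 c) => d d01.
have [/= y0 y1] := set_valP y; rewrite inE; split=> [i|].
  rewrite !mxE addr_ge0 // mulr_ge0 ?ler0n ?subr_ge0 //; by case/andP: d01.
under eq_bigr do rewrite !mxE.
rewrite big_split /= -!mulr_sumr y1 (bigD1 ord0) //= big1 ?addr0 ?mulr1 ?subrK //.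
by move=> i /negPf ->.
Qed.

Definition contract (c : R) (y : Delta) : Delta :=
  exist _ (contract_mx c y) (contract_subproof c y).

Lemma contract_continuous c : continuous (contract c).
Proof.
apply: (@continuous_comp_initial _ _ _ set_val).
apply: continuous_addmx; first exact: continuous_const.
apply: continuous_scalemx; first exact: continuous_const.
exact: (@initial_continuous _ _ set_val).
Qed.

(** Contracting the simplex linearly to a vertex in small steps joins a constant map to [f] by a
    chain to which [chain_lift] applies. *)
Lemma simplex_lift (f : Delta -> RP1 R) : continuous f ->
  exists2 theta : Delta -> R, continuous theta & forall y, f y = rp1_angle (theta y).
Proof.
move=> cf; have [N HN] := simplex_mesh cf.
(* Balls are open: a step of 1 / (N + 2) stays strictly below the mesh 1 / (N + 1). For j beyond N +
   2 the clamping makes the chain stationary. *)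
pose c (j : nat) : R := j%:R / N.+2%:R.
have v0s : vertex0 \in @simplex R k.
  rewrite inE; split=> [i|]; first by rewrite mxE ler0n.
  by rewrite (bigD1 ord0) //= big1 ?addr0 ?mxE // => i /negPf i0; rewrite mxE i0.
have [|||theta ctheta fE] := @chain_lift R Delta
  (fun j y => f (contract (c j) y)) N.+2 (exist _ vertex0 v0s).
- by move=> j y; exact: (continuous_comp (@contract_continuous (c j) y) (cf _)).
- move=> y; congr f; apply/val_inj; rewrite /= /contract_mx.
  by rewrite /c mul0r clamp01_le0 // !scale0r.
- move=> j y; apply: HN; split; first by rewrite invr_gt0 ltr0n.
  move=> a i; rewrite ord1 /ball /= /contract_mx.
  set d := clamp01 (c j); set d' := clamp01 (c j.+1).
  have -> : ((1 - d) *: vertex0 + d *: val y) 0 i - ((1 - d') *: vertex0 + d' *: val y) 0 i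
     = (d' - d) * (vertex0 0 i - val y 0 i) by rewrite !mxE; ring.
  have c1 : c j.+1 = c j + N.+2%:R^-1 by rewrite /c -natr1 mulrDl mul1r.
  have N2 : 0 < N.+2%:R^-1 :> R by rewrite invr_gt0 ltr0n.
  have cj : 0 <= c j by rewrite divr_ge0.
  have dd : 0 <= d' - d <= N.+2%:R^-1.
    rewrite /d /d' c1 (clamp01_ge0E cj) (clamp01_ge0E (addr_ge0 cj (ltW N2))).
    move: (c j) (_^-1) cj N2 => u e u0 e0.
    by case: (leP 1 u) => ?; case: (leP 1 (u + e)) => ?; apply/andP; split; lra.
  have vy : `|vertex0 0 i - val y 0 i| <= 1.
    have /andP[y0 y1] := simplex_le1 y i; rewrite ler_norml mxE eqxx /=.
    change (sval y) with (val y); move: (val y 0 i) y0 y1 => q y0 y1.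
    by case: eqP => _ /=; apply/andP; split; lra.
  rewrite normrM (le_lt_trans (y := N.+2%:R^-1)) //.
    rewrite -[leRHS]mulr1; apply: ler_pM => //; rewrite ger0_norm //; by case/andP: dd.
  by rewrite ltf_pV2 ?posrE ?ltr0n // ltr_nat.
- exists theta => // y; rewrite -fE; congr f; apply/val_inj; rewrite /= /contract_mx.
  rewrite /c mulfV ?pnatr_eq0 // clamp01_ge1 //.
  by rewrite subrr scale0r add0r scale1r.
Qed.

End SimplexLift.

(** * The winding cocycle *)

Lemma face_mx_delta (R : realType) (k : nat) (i : 'I_k.+2) (a : 'I_k.+1) :
  face_mx i (delta_mx 0 a) = delta_mx 0 (lift i a) :> 'rV[R]_k.+2.
Proof.
apply/rowP => j; rewrite !mxE eqxx /=; case: unliftP => [b ->|->] /=.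
  by rewrite mxE eqxx (inj_eq lift_inj).
by rewrite (negPf (neq_lift _ _)).
Qed.

Section Cocycle.
Variable R : realType.
Local Notation Delta1 := (set_type (@simplex R 1)).

Definition segment_mx (t : R) : 'rV[R]_2 := row2 (1 - clamp01 t) (clamp01 t).

Lemma segment_subproof t : segment_mx t \in @simplex R 1.
Proof.
have /andP[c0 c1] := clamp01_itv t.
rewrite inE; split=> [i|]; first by rewrite mxE; case: ifP => _ //; rewrite subr_ge0.
by rewrite !big_ord_recl big_ord0 !mxE /= addr0 subrK.
Qed.

Definition segment (t : R) : Delta1 := exist _ (segment_mx t) (segment_subproof t).

Lemma segment_mx0 : segment_mx 0 = delta_mx 0 0.
Proof.
rewrite /segment_mx clamp01_id ?lexx ?ler01 //; apply/rowP => i; rewrite !mxE eqxx subr0.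
by case: eqP.
Qed.

Lemma segment_mx1 : segment_mx 1 = delta_mx 0 1.
Proof.
rewrite /segment_mx clamp01_id ?lexx ?ler01 //; apply/rowP => i; rewrite !mxE eqxx subrr.
by case: i => -[|[|//]] i.
Qed.

Lemma segment_continuous : continuous segment.
Proof.
apply: (@continuous_comp_initial _ _ _ set_val).
have cc := @clamp01_continuous R.
apply: mx_continuous => i j; rewrite /= /segment_mx.
apply: (continuous_ext (f := fun t => if j == 0 then 1 + (-1) * clamp01 t else clamp01 t)).
  by move=> t; rewrite mxE mulN1r.
case: eqP => // _; apply: continuous_add; first exact: continuous_const.
by apply: continuous_mul => //; exact: continuous_const.
Qed.

Lemma segment_coord t : simplex1_coord (segment t) = clamp01 t.
Proof. by rewrite /simplex1_coord /= mxE. Qed.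

Lemma lift_unique (theta theta' : R -> R) : continuous theta -> continuous theta' ->
  (forall t, rp1_angle (theta t) = rp1_angle (theta' t)) ->
  theta 1 - theta 0 = theta' 1 - theta' 0.
Proof.
move=> c c' e.
pose g t := (theta t - theta' t) / pi.
have gi t : g t \is a Num.int by apply/rp1_angle_eq.
have cg : continuous g.
  apply: (continuous_ext (f := fun t => (theta t + (-1) * theta' t) * pi^-1)).
    by move=> t; rewrite mulN1r.
  apply: continuous_mul; last exact: continuous_const.
  by apply: continuous_add => //; apply: continuous_mul => //; exact: continuous_const.
suff e01 : g 0 = g 1.
  have : theta 0 - theta' 0 = theta 1 - theta' 1.
    by apply: mulIf e01; rewrite invr_eq0 gt_eqF ?pi_gt0.
  lra.
apply: contrapT => /eqP ne.
(* [g] is continuous with integer values. If g 0 and g 1 differed, their minimum plus 1/2 would be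
   attained, but it is not an integer. *)
have [c0 _ gc] : exists2 t, t \in `[0, 1] & g t = Order.min (g 0) (g 1) + 2^-1.
  apply: IVT => //; first by apply: continuous_subspaceT.
  have [a ga] := intrP (gi 0); have [b gb] := intrP (gi 1).
  rewrite lerDl invr_ge0 ler0n /=; move: ne; rewrite ga gb eqr_int => ab.
  have [ltab|ltba] : (a + 1 <= b) \/ (b + 1 <= a) by lia.
    have : (a + 1)%:~R <= b%:~R :> R by rewrite ler_int.
    by rewrite intrD => h; rewrite min_l ?max_r; lra.
  have : (b + 1)%:~R <= a%:~R :> R by rewrite ler_int.
  by rewrite intrD => h; rewrite min_r ?max_l; lra.
have : 2^-1 \is a @Num.int R.
  rewrite -[2^-1](addKr (Order.min (g 0) (g 1))) -gc rpredD ?rpredN //.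
  by rewrite minEle; case: ifP.
move=> /intrP[z /eqP]; rewrite -subr_eq0 => /eqP h2.
have h3 : (1 : int)%:~R = (z * 2)%:~R :> R.
  rewrite intrM; have : z%:~R = 2^-1 :> R by lra.
  by move=> ->; rewrite mulVf ?pnatr_eq0.
by move: h3 => /eqP; rewrite eqr_int; lia.
Qed.

Variable o : bool.
Let eps : R := (-1) ^+ o * pi.

Lemma eps_neq0 : eps != 0.
Proof. by rewrite mulf_neq0 ?signr_eq0 ?gt_eqF ?pi_gt0. Qed.

Definition section_angle (W : RP1 R) : R := projT1 (cid (rp1_angle_surj W)).

Lemma section_angleK W : rp1_angle (section_angle W) = W.
Proof. exact: projT2 (cid (rp1_angle_surj W)). Qed.

Definition angle_defect (theta : R) : R := theta - section_angle (rp1_angle theta).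

Lemma angle_defect_int theta : angle_defect theta / eps \is a Num.int.
Proof.
have : angle_defect theta / pi \is a Num.int.
  by apply/rp1_angle_eq; rewrite section_angleK.
rewrite /eps invfM mulrCA; case: o => /=; last by rewrite invr1 mul1r.
by rewrite invrN1 mulN1r rpredN.
Qed.

Definition winds (s : singular R 1 (RP1 R)) (z : int) : Prop :=
  exists theta : Delta1 -> R, [/\ continuous theta, forall y, s y = rp1_angle (theta y) &
    (angle_defect (theta (segment 1)) - angle_defect (theta (segment 0))) / eps = z%:~R].

Lemma winds_exists s : exists z, winds s z.
Proof.
have [theta ct sE] := simplex_lift (@cts_fun _ _ s).
have : (angle_defect (theta (segment 1)) - angle_defect (theta (segment 0))) / eps
    \is a Num.int.
  by rewrite mulrBl rpredB // angle_defect_int.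
by move=> /intrP[z zE]; exists z, theta.
Qed.

Lemma winds_inj s z z' : winds s z -> winds s z' -> z = z'.
Proof.
move=> [theta [ct sE zE]] [theta' [ct' sE' zE']].
apply/eqP; rewrite -(eqr_int R) -zE -zE'; apply/eqP; congr (_ / _).
rewrite /angle_defect -!sE -!sE'.
have cs (f : Delta1 -> R) : continuous f -> continuous (f \o segment).
  by move=> cf t; exact: (continuous_comp (@segment_continuous t) (cf _)).
have := lift_unique (cs _ ct) (cs _ ct') (fun t => etrans (esym (sE _)) (sE' _)).
by rewrite /=; lra.
Qed.

Definition winding_cochain : cochain R (RP1 R) 1 := fun s => projT1 (cid (winds_exists s)).

Lemma winding_cochainP s : winds s (winding_cochain s).
Proof. exact: projT2 (cid (winds_exists s)). Qed.

(** A single lift of the 2-simplex restricts to a lift of each face, so the defects at the three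
    vertices cancel in the alternating sum. *)
Lemma winding_cocycle_subproof : winding_cochain \in @cocycle R (RP1 R).
Proof.
suff c0 : coboundary winding_cochain = 0 :> (singular R 2 (RP1 R) -> int).
  by rewrite inE; apply/eqP/eqP; exact: c0.
apply: funext => s.
have [th cT sE] := simplex_lift (@cts_fun _ _ s).
have cE (i : 'I_3) : (winding_cochain (s \o face i : continuousType _ _))%:~R =
    (angle_defect (th (face i (segment 1))) - angle_defect (th (face i (segment 0)))) / eps.
  have [z zE] : exists z : int, (angle_defect (th (face i (segment 1))) -
      angle_defect (th (face i (segment 0)))) / eps = z%:~R.
    by apply/intrP; rewrite mulrBl rpredB // angle_defect_int.
  rewrite zE; congr (_%:~R); apply: winds_inj (winding_cochainP _) _.
  exists (th \o face i); split=> [|y|//]; last by rewrite /= sE.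
  by move=> y; exact: (continuous_comp (@face_continuous R 1 i y) (cT _)).
have fE (i j : 'I_3) (a b : 'I_2) (t u : R) : segment_mx t = delta_mx 0 a ->
    segment_mx u = delta_mx 0 b -> lift i a = lift j b ->
    face i (segment t) = face j (segment u).
  by move=> ta ub ab; apply/val_inj; rewrite /= ta ub !face_mx_delta ab.
have f01 : face 0 (segment 1) = face 1 (segment 1).
  by apply: (fE _ _ _ _ _ _ segment_mx1 segment_mx1); apply/val_inj.
have f02 : face 0 (segment 0) = face (lift 0 (lift 0 0) : 'I_3) (segment 1).
  by apply: (fE _ _ _ _ _ _ segment_mx0 segment_mx1); apply/val_inj.
have f12 : face 1 (segment 0) = face (lift 0 (lift 0 0) : 'I_3) (segment 0).
  by apply: (fE _ _ _ _ _ _ segment_mx0 segment_mx0); apply/val_inj.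
apply/eqP; rewrite -(eqr_int R) /coboundary !big_ord_recl big_ord0 /=.
rewrite expr0 mul1r expr1 mulN1r sqrrN expr1n mul1r addr0 !intrD rmorphN /=.
have -> : lift ord0 ord0 = 1 :> 'I_3 by apply/val_inj.
rewrite !cE f01 f02 f12; apply/eqP.
by move: (eps^-1); clear; move=> e; ring.
Qed.

Definition winding_cocycle : cocycles R (RP1 R) := Cocycle winding_cocycle_subproof.

Lemma winding_cocycle_loop (d : loop R (RP1 R)) :
  exists theta : R -> R, [/\ continuous theta,
    forall t, 0 <= t <= 1 -> d t = rp1_angle (theta t) &
    theta 1 - theta 0 = eps * (winding_cochain (loop_cycle d))%:~R].
Proof.
have [th [ct dE zE]] := winding_cochainP (loop_cycle d).
exists (th \o segment); split=> [t|t t01|].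
- exact: (continuous_comp (@segment_continuous t) (ct _)).
- by rewrite /= -dE /= segment_coord clamp01_id.
have d01 : d 1 = d 0 by rewrite -[1]add0r loop_periodic.
rewrite -zE mulrC divfK ?eps_neq0 // /angle_defect -!dE /= !segment_coord.
by rewrite clamp01_id ?lexx ?ler01 // clamp01_id ?lexx ?ler01 // d01; ring.
Qed.

Lemma winding_cochain_rp1_loop : winding_cochain (loop_cycle (rp1_loop R o)) = 1.
Proof.
have [theta [ct dE zE]] := winding_cocycle_loop (rp1_loop R o).
pose th' t : R := eps * clamp01 t.
have ct' : continuous th'.
  by apply: continuous_mul; [exact: continuous_const|exact: clamp01_continuous].
have ctc : continuous (theta \o @clamp01 R).
  by move=> t; exact: (continuous_comp (@clamp01_continuous R t) (ct _)).
have e t : rp1_angle ((theta \o @clamp01 R) t) = rp1_angle (th' t).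
  by rewrite /= -dE ?clamp01_itv.
have := lift_unique ctc ct' e; rewrite /th' /= !clamp01_id ?lexx ?ler01 //.
rewrite zE mulr1 mulr0 subr0 -[RHS]mulr1 => /(mulfI eps_neq0)/eqP.
by rewrite (eqr_int _ _ 1) => /eqP.
Qed.

Lemma pairingMz (X : topologicalType) (a : H1 R X) (z : int) (g : loop R X) :
  pairing (a *~ z) g = pairing a g * z.
Proof.
have pD (b c : H1 R X) : pairing (b + c) g = pairing b g + pairing c g.
  by rewrite -[b]reprK -[c]reprK -[in LHS]raddfD !pairing_pi raddfD.
have pN (b : H1 R X) : pairing (- b) g = - pairing b g.
  by rewrite -[b]reprK -[in LHS]raddfN !pairing_pi raddfN.
have p0 : pairing (0 : H1 R X) g = 0.
  by apply: (addrI (pairing 0 g)); rewrite -pD !addr0.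
have pn (k : nat) : pairing (a *+ k) g = pairing a g *+ k.
  by elim: k => [|k IH]; rewrite ?p0 // !mulrS pD IH.
case: z => k; first by rewrite -pmulrn pn -mulr_natr natz.
by rewrite NegzE mulrNz -pmulrn pN pn mulrN -mulr_natr natz.
Qed.

(** The class [nu] of the explicit cocycle is a multiple z [mu]; both pair to 1 with the standard
    loop, so z = 1. *)
Lemma generator_pairing (mu : H1 R (RP1 R)) (d : loop R (RP1 R)) :
  orientation_generator o mu -> pairing mu d = winding_cochain (loop_cycle d).
Proof.
move=> [gen mu1]; pose nu : H1 R (RP1 R) := (\pi_(H1 R (RP1 R)) winding_cocycle)%qT.
have nuE d' : pairing nu d' = winding_cochain (loop_cycle d') by exact: pairing_pi.
have [z nuz] := gen nu.
have := nuE (rp1_loop R o); rewrite winding_cochain_rp1_loop nuz pairingMz mu1 mul1r => z1.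
by rewrite -nuE nuz z1.
Qed.

End Cocycle.

(** * Extending a lift from the unit interval to the line *)

Section PeriodicExtension.
Variables (R : realType) (theta : R -> R).
Hypothesis ct : continuous theta.

Let D := theta 1 - theta 0.
Let g t := theta (clamp01 t) - theta 0.

Let g_le0 t : t <= 0 -> g t = 0.
Proof. by move=> t0; rewrite /g clamp01_le0 // subrr. Qed.

Let g_ge1 t : 1 <= t -> g t = D.
Proof. by move=> t1; rewrite /g clamp01_ge1. Qed.

(* The k-th summand vanishes when |t| <= k, so the sum is locally finite. *)
Definition extend_upto (K : nat) (t : R) : R :=
  theta 0 + \sum_(0 <= k < K) (g (t - k%:R) + g (t + k.+1%:R) - D).

Definition extend (t : R) : R := extend_upto (Num.truncn `|t|).+2 t.

Lemma extend_upto_stable K t : `|t| <= K%:R -> extend_upto K t = extend t.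
Proof.
have step k : `|t| <= k%:R -> extend_upto k.+1 t = extend_upto k t.
  rewrite ler_norml => /andP[tk kt]; rewrite /extend_upto big_nat_recr //= addrA.
  rewrite g_le0 ?subr_le0 // g_ge1 ?add0r ?subrr ?addr0 //.
  by rewrite -natr1; lra.
have far k j : `|t| <= k%:R -> extend_upto (k + j) t = extend_upto k t.
  move=> tk; elim: j => [|j IH]; rewrite ?addn0 // addnS step ?IH //.
  by rewrite (le_trans tk) // ler_nat leq_addr.
have tt : `|t| <= (Num.truncn `|t|).+2%:R.
  by rewrite (le_trans (ltW (truncnS_gt _))) // ler_nat.
move=> tK; rewrite /extend; have [Kt|tK'] := leqP K (Num.truncn `|t|).+2.
  by rewrite -(subnKC Kt) far.
by rewrite -(subnKC (ltnW tK')) far.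
Qed.

Lemma extend_continuous : continuous extend.
Proof.
have cg : continuous g.
  apply: (continuous_ext (f := fun t => theta (clamp01 t) + (- theta 0))) => //.
  apply: continuous_add; last exact: continuous_const.
  by move=> t; exact: (continuous_comp (@clamp01_continuous R t) (@ct _)).
have cK K : continuous (extend_upto K).
  apply: continuous_add; first exact: continuous_const.
  apply: sum_continuous => k.
  have cs (a : R) : continuous (fun t => g (t + a)).
    have ca : continuous (fun t : R => t + a).
      by apply: continuous_add; [move=> t; exact: cvg_id|exact: continuous_const].
    by move=> t; exact: (continuous_comp (ca t) (cg _)).
  apply: continuous_add; last exact: continuous_const.
  by apply: continuous_add; exact: cs.
move=> t0; pose K := (Num.truncn `|t0|).+2.
have near_K : \forall t \near t0, extend_upto K t = extend t.
  have lt1 : `|t0| < K%:R by rewrite (lt_le_trans (truncnS_gt _)) // ler_nat.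
  have nt : \forall t \near t0, `|t| < K%:R.
    by apply: (cvgr_lt _ (@norm_continuous _ _ t0)).
  by apply: filterS nt => t tK; apply: extend_upto_stable; apply: ltW.
rewrite /continuous_at -(extend_upto_stable (K := K)).
  exact: (cvg_trans (near_eq_cvg near_K) (cK K t0)).
by rewrite ltW // (lt_le_trans (truncnS_gt _)) // ler_nat.
Qed.

Lemma extend_shift t : extend (t + 1) = extend t + D.
Proof.
pose K := (Num.truncn `|t|).+2.
have tK : `|t| + 1 <= K%:R.
  by rewrite /K -natr1 lerD2r ltW // truncnS_gt.
rewrite -(extend_upto_stable (K := K)); last by rewrite (le_trans (ler_normD _ _)) ?normr1.
rewrite -(extend_upto_stable (K := K)); last by rewrite (le_trans _ tK) // lerDl.
move: tK; rewrite -lerBrDr ler_norml => /andP[tK Kt].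
rewrite /extend_upto -addrA; congr (_ + _).
rewrite addrC; apply/eqP; rewrite -subr_eq -sumrB; apply/eqP.
(* The difference of the two sums, cut off at a [K] valid for both t and t + 1, splits into two
   telescoping sums; what remains is g (t + 1 + K) - g (t + 1 - K) = D. *)
transitivity (\sum_(0 <= k < K) ((- g (t + 1 - k.+1%:R) - - g (t + 1 - k%:R)) +
    (g (t + 1 + k.+1%:R) - g (t + 1 + k%:R)))).
  apply: eq_bigr => k _; rewrite -!natr1.
  have -> : t + 1 - (k%:R + 1) = t - k%:R by ring.
  have -> : t + (k%:R + 1) = t + 1 + k%:R by ring.
  by ring.
rewrite big_split /= !telescope_sumr // !subr0 addr0.
rewrite (g_le0 (t := t + 1 - K%:R)); last by lra.
rewrite (g_ge1 (t := t + 1 + K%:R)); last by lra.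
by ring.
Qed.

Lemma extend_id t : 0 <= t <= 1 -> extend t = theta t.
Proof.
move=> /andP[t0 t1]; rewrite -(extend_upto_stable (K := 1)) ?ger0_norm //.
rewrite /extend_upto big_nat1 subr0 (g_ge1 (t := t + 1)) ?lerDr //.
by rewrite addrK /g clamp01_id ?t0 // addrC subrK.
Qed.

End PeriodicExtension.

(** The simplex yields a lift on [0, 1] only, while [winding_number] asks for one on R. The
    extension shifts by a multiple of pi over each period, so it is a lift everywhere. *)
Lemma winding_number_cochain (R : realType) (o : bool) (d : loop R (RP1 R)) :
  winding_number o d (winding_cochain o (loop_cycle d)).
Proof.
have [theta [ct dE zE]] := winding_cocycle_loop o d.
exists (extend theta); split; first exact: extend_continuous.
  pose Q t := d t = rp1_angle (extend theta t).
  have Q1 t : Q (t + 1) <-> Q t.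
    rewrite /Q loop_periodic extend_shift zE.
    suff -> : rp1_angle (extend theta t +
        (-1) ^+ o * pi * (winding_cochain o (loop_cycle d))%:~R) =
      rp1_angle (extend theta t) by [].
    apply/rp1_angle_eq; rewrite addrAC subrr add0r mulrAC mulfK ?gt_eqF ?pi_gt0 //.
    by rewrite rpredM ?intr_int // rpredX // rpredN rpred1.
  have Qn t (n : nat) : Q (t + n%:R) <-> Q t.
    by elim: n => [|n IH]; rewrite ?addr0 // -natr1 addrA Q1.
  have Qz t (z : int) : Q (t + z%:~R) <-> Q t.
    case: z => n; first by rewrite -pmulrn.
    by rewrite NegzE mulrNz -pmulrn -(Qn (t - _) n.+1) subrK.
  move=> t; rewrite -/(Q t) -[t](subrK (Num.floor t)%:~R) Qz /Q.
  have t01 : 0 <= t - (Num.floor t)%:~R <= 1.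
    have := floor_le t; have := floorD1_gt t; rewrite intrD1 => h1 h2.
    by apply/andP; split; lra.
  by rewrite extend_id // dE.
by rewrite !extend_id ?lexx ?ler01.
Qed.

(** * The intersection number *)

Section CrossingSign.
Variable R : realType.

Lemma is_derive_sign (a : R -> R) (t0 a' : R) : is_derive t0 1 a a' -> a t0 = 0 -> a' != 0 ->
  \forall t \near t0, t != t0 -> 0 < a' * a t * (t - t0).
Proof.
move=> [da a'E] at0 a'0.
have cv : h^-1 *: (a (h *: (1 : R) + t0) - a t0) @[h --> 0^'] --> a' by rewrite -a'E; exact: da.
have : \forall h \near 0^', 0 < a' * (h^-1 *: (a (h *: (1 : R) + t0) - a t0)).
  apply: (cvgr_gt (a' * a')); last by rewrite -expr2 lt0r sqrf_eq0 a'0 sqr_ge0.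
  by apply: cvgM => //; exact: cvg_cst.
move=> /nbhs_ballP[e /= e0 He]; apply/nbhs_ballP; exists e => //= t tt0 nt.
have /He : ball 0 e (t - t0).
  by rewrite /ball /= sub0r normrN distrC.
rewrite subr_eq0 => /(_ nt).
rewrite /GRing.scale /= mulr1 subrK at0 subr0 => h.
have st : 0 < (t - t0) ^+ 2 by rewrite lt0r sqrf_eq0 subr_eq0 nt sqr_ge0.
have -> : a' * a t * (t - t0) = a' * ((t - t0)^-1 * a t) * (t - t0) ^+ 2.
  by field; rewrite subr_eq0.
exact: mulr_gt0.
Qed.

Lemma sin_sign (d : R) : `|d| < pi / 2 -> d != 0 -> 0 < sin d * d.
Proof.
rewrite ltr_norml => /andP[l r]; case: (ltgtP d 0) => // d0 _.
  rewrite -mulrNN -sinN mulr_gt0 ?oppr_gt0 //; apply: sin_gt0_pihalf.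
  by rewrite oppr_gt0 d0 ltrNl.
by rewrite mulr_gt0 // sin_gt0_pihalf // d0.
Qed.

(** Here a and b are [w1] and [w2] on the moving basis, a' the derivative of a and b0 the value of
    [w2] at the crossing, s the elapsed time, d the change of angle, C and S its cosine and sine.
    The product of the positive quantities is a square times the goal. *)
Lemma crossing_sign_product (sg a a' b b0 s C S d : R) :
  0 < a' * a * s -> 0 < - (a' * b0 * sg) -> 0 < b * b0 -> a * C = - (b * S) -> 0 < C ->
  0 < S * d -> 0 < sg * d * s.
Proof.
move=> h1 h2 h3 e C0 Sd.
have S0 : S != 0 by apply: contraTneq Sd => ->; rewrite mul0r ltxx.
have a0 : a' != 0 by apply: contraTneq h1 => ->; rewrite !mul0r ltxx.
have p : 0 < (a' * a * s) * - (a' * b0 * sg) * C * (b * b0) * (S * d).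
  by do 4![apply: mulr_gt0 => //].
have q : (a' * a * s) * - (a' * b0 * sg) * C * (b * b0) * (S * d) =
    ((a' * (b * b0) * S) ^+ 2) * (sg * d * s).
  transitivity (- a' ^+ 2 * (b0 * s * sg * (b * b0) * (S * d)) * (a * C)); first by ring.
  by rewrite e; ring.
have b0n : b * b0 != 0 by rewrite gt_eqF.
by move: p; rewrite q pmulr_rgt0 // lt0r sqrf_eq0 sqr_ge0 andbT (mulf_neq0 (mulf_neq0 a0 b0n) S0).
Qed.

End CrossingSign.

Section Intersection.
Variables (R : realType) (n : nat) (P : grassmannian R n (2 * n)).
Variables w1 w2 : exterior_form R n (2 * n).
Hypotheses (n_gt0 : (1 <= n)%N)
  (ker_w1 : forall v : 'rV[R]_(2 * n), form_ker w1 v <-> (v <= P)%MS).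
Variable o : bool.

Let M := pencil_domain w1 w2.
Let phi : continuousType (set_type M) (RP1 R) := @pencil_map R _ _ w1 w2.

Variables (gamma : loop R (set_type M)) (theta : R -> R).
Hypotheses (ctheta : continuous theta)
  (thetaE : forall t, phi (gamma t) = rp1_angle (theta t)).

Let c t := val (gamma t).
Hypothesis gen_c : sufficiently_generic P c.

(** The shift by 1/2 places the zeros of cos theta at the integers. *)
Let h t := theta t / pi + 2^-1.

Lemma angle_basis t U : (U == c t)%MS -> w1 U * sin (theta t) = w2 U * cos (theta t).
Proof.
move=> Uc; have [V [Vc wV]] := set_valP (gamma t).
have := thetaE t; rewrite /phi /= (pencil_mapE wV Vc) => /hpoint_eq.
have [G _ ->] := basis_change Vc Uc.
by rewrite !form_mulmx -!mulrA => ->.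
Qed.

Lemma cos_half_int t : cos (theta t) = 0 <-> h t \is a Num.int.
Proof.
rewrite -sin_pi_int /h mulrDr mulrCA mulfV ?gt_eqF ?pi_gt0 // mulr1.
by rewrite sinDpihalf.
Qed.

Lemma train_angle t : train P (c t) <-> h t \is a Num.int.
Proof.
have [U Uc] := gr_basis (c t); rewrite (trainE n_gt0 ker_w1 Uc) -cos_half_int.
have e := angle_basis Uc; split=> e0.
  move/eqP: e; rewrite e0 mul0r eq_sym mulf_eq0.
  rewrite (negPf (train_w2_neq0 (w2 := w2) n_gt0 ker_w1 _ _ Uc)) /=; first by move/eqP.
    exact/(trainE n_gt0 ker_w1 Uc).
  exact: set_valP.
move/eqP: e; rewrite e0 mulr0 mulf_eq0 => /orP[/eqP//|/eqP s0].
by case: (cos_sin_neq0 (theta t)) => /eqP.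
Qed.

Let pos := positive_side w1 w2 o.
(** The factor converts the sign for the orientation [o] into the direction in which the angle
    itself moves. *)
Let sg t : int := (-1) ^+ o * crossing_sign pos c t.

Lemma crossing_signE t : crossing_sign pos c t = 1 \/ crossing_sign pos c t = -1.
Proof. by rewrite /crossing_sign; case: ifP; [left|right]. Qed.

Lemma crossing_local t0 : h t0 \is a Num.int ->
  \forall t \near t0, t != t0 -> 0 < (sg t0)%:~R * (h t - h t0) * (t - t0).
Proof.
have [sc c1 c2] := gen_c => /[dup] ht0 /train_angle t0P.
have tW := c1 _ t0P; set W := c t0 in tW t0P.
have [U0 UW] := gr_basis W; set X := velocity c t0.
have TX : gr_tangent W X by exact: velocity_gr_tangent.
have w2U : w2 U0 != 0 by apply: (train_w2_neq0 n_gt0 ker_w1 t0P _ UW); exact: set_valP.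
have U0Q : U0 *m orth_proj W = U0 by apply: orth_proj_id; rewrite (eqmxP UW).
pose B t := U0 *m orth_proj (c t).
have cc : continuous c.
  move=> t; apply: (continuous_comp (f := gamma) (g := @set_val _ M)).
    exact: cts_fun.
  exact: (@initial_continuous _ _ set_val).
have cB : continuous B.
  apply: continuous_mulmx; first exact: continuous_const.
  by move=> t; exact: (continuous_comp (cc t) (@orth_proj_continuous _ _ _ _)).
have d_w1 : is_derive t0 1 (fun t => w1 (B t)) (dform w1 U0 (U0 *m X)).
  have dB : mx_derive B t0 (U0 *m X).
    have := mx_deriveM (mx_derive_cst U0 t0) (velocity_mx_derive t0 sc).
    by rewrite mul0mx add0r.
  by have := is_derive_form w1 dB; rewrite /B U0Q.
(* This is where genericity enters: a zero differential would make the velocity tangent to the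
   train. *)
have d0 : dform w1 U0 (U0 *m X) != 0.
  apply/eqP => d0; apply: (c2 _ tW); exact: (dform_train1_tangent n_gt0 ker_w1 tW UW).
have w1B0 : w1 (B t0) = 0 by rewrite /B U0Q; apply/(trainE n_gt0 ker_w1 UW).
have near1 := is_derive_sign d_w1 w1B0 d0.
have near2 : \forall t \near t0, 0 < w2 (B t) * w2 U0.
  apply: (near_sign (f := fun t => w2 (B t) * w2 U0)).
    by apply: continuous_mul; [exact: continuous_form|exact: continuous_const].
  by rewrite /B U0Q -expr2 lt0r sqrf_eq0 w2U sqr_ge0.
have near3 : \forall t \near t0, `|theta t - theta t0| < pi / 2.
  have pi2 : 0 < pi / 2 :> R by rewrite divr_gt0 ?pi_gt0.
  have := @ctheta t0 => /cvgr_dist_lt/(_ _ pi2).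
  by apply: filterS => t; rewrite distrC.
have sgn : 0 < - (dform w1 U0 (U0 *m X) * w2 U0 * (sg t0)%:~R).
  have tE : turning w1 w2 o U0 X = - ((-1) ^+ o * (dform w1 U0 (U0 *m X) * w2 U0)).
    by rewrite /turning mulNr.
  have sgE : (sg t0)%:~R = (-1) ^+ o * (if 0 < turning w1 w2 o U0 X then 1 else -1) :> R.
    rewrite /sg /crossing_sign intrM rmorphXn rmorphN1; congr (_ * _).
    rewrite (_ : velocity c t0 \in pos (c t0) = (0 < turning w1 w2 o U0 X)).
      by case: ifP; rewrite ?rmorphN1.
    apply/idP/idP => [/set_mem/(positive_sideE _ _ _ _ UW)[]//|tp].
    by apply/mem_set/(positive_sideE _ _ _ _ UW).
  have t_neq0 : turning w1 w2 o U0 X != 0.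
    by rewrite tE oppr_eq0 !mulf_neq0 ?signr_eq0.
  have -> : - (dform w1 U0 (U0 *m X) * w2 U0 * (sg t0)%:~R) =
      turning w1 w2 o U0 X * (if 0 < turning w1 w2 o U0 X then 1 else -1).
    by rewrite sgE; move: (if _ then _ else _) => s; rewrite tE; ring.
  case: ifP => [tp|/negbT]; first by rewrite mulr1.
  by rewrite -leNgt => tn; rewrite mulrN1 oppr_gt0 lt_neqAle t_neq0.
apply: filterS3 near1 near2 near3 => t n1 n2 n3 nt.
have wB : w2 (B t) != 0 by apply: contraTneq n2 => ->; rewrite mul0r ltxx.
have Bc : (B t == c t)%MS.
  by apply: eqmx_span; [exact: orth_proj_sub|exact: form_row_free wB].
have e := angle_basis Bc.
set d := theta t - theta t0.
have ct0 : cos (theta t0) = 0 by apply/cos_half_int.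
have st0 : sin (theta t0) != 0.
  by case: (cos_sin_neq0 (theta t0)) => //; rewrite ct0 eqxx.
have td : theta t = theta t0 + d by rewrite /d addrC subrK.
(* At the crossing the cosine vanishes, so the addition formulas leave a common factor sin (theta
   t0), which is cancelled. *)
have eC : w1 (B t) * cos d = - (w2 (B t) * sin d).
  apply: (mulIf st0); move: e; rewrite td sinD cosD ct0 !mul0r addr0 add0r.
  by rewrite mulrN => e; rewrite -mulrA [cos d * _]mulrC e; ring.
have C0 : 0 < cos d by apply: cos_gt0_pihalf; rewrite -ltr_norml.
have dn0 : d != 0.
  apply/eqP => dz; move: eC; rewrite dz cos0 sin0 mulr1 mulr0 oppr0 => w0.
  by have := n1 nt; rewrite w0 mulr0 mul0r ltxx.
have := crossing_sign_product (n1 nt) sgn n2 eC C0 (sin_sign n3 dn0).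
have -> : h t - h t0 = d / pi by rewrite /h /d; ring.
have -> : (sg t0)%:~R * (d / pi) * (t - t0) = (sg t0)%:~R * d * (t - t0) / pi by ring.
by move=> p; rewrite divr_gt0 ?pi_gt0.
Qed.

Lemma crossing_sign_periodic : crossing_sign pos c 1 = crossing_sign pos c 0.
Proof.
have c1 t : c (t + 1) = c t by rewrite /c loop_periodic.
have vE : velocity c 1 = velocity c 0.
  apply/matrixP => i j; rewrite !mxE /derive1.
  have -> : (fun h0 => h0^-1 *: (orth_proj (c (h0 + 1)) i j - orth_proj (c 1) i j)) =
     (fun h0 => h0^-1 *: (orth_proj (c (h0 + 0)) i j - orth_proj (c 0) i j)).
    by apply/funext => h0; rewrite c1 addr0 -[1]add0r c1.
  by [].
by rewrite /crossing_sign vE -[1]add0r c1.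
Qed.

Lemma winding_intersection_number (z : int) :
  theta 1 - theta 0 = (-1) ^+ o * pi * z%:~R -> intersection_number P pos c z.
Proof.
move=> zE.
have ch : continuous h.
  apply: continuous_add; last exact: continuous_const.
  by apply: continuous_mul => //; exact: continuous_const.
have sgE t : sg t = 1 \/ sg t = -1.
  rewrite /sg; case: (crossing_signE t) => ->; case: o; rewrite ?mulr1 ?mulrN1 ?opprK;
    by [left|right].
have ctE : crossing_times P c = crossings h 0 1.
  by apply/seteqP; split=> t [t01 /train_angle].
have [fin sumE] := crossing_count ch sgE crossing_local ler01.
split; first by rewrite ctE.
have h1 : h 1 = h 0 + ((-1) ^+ o * z)%:~R.
  rewrite intrM rmorphXn rmorphN1 /h.
  have -> : theta 1 = theta 0 + (-1) ^+ o * pi * z%:~R by rewrite -zE addrC subrK.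
  by rewrite mulrDl addrAC mulrAC mulfK ?gt_eqF ?pi_gt0.
have s1 : sg 1 = sg 0 by rewrite /sg crossing_sign_periodic.
(* h 0 and h 1 differ by an integer and [sg] agrees at both ends, so the endpoint corrections in
   [left_floor] cancel. *)
have lf : left_floor h sg 1 - left_floor h sg 0 = (-1) ^+ o * z.
  have floorDz (x : R) (m : int) : Num.floor (x + m%:~R) = Num.floor x + m.
    apply: floor_def; have /andP[] := floor_itv x; rewrite !intrD => l r.
    by apply/andP; split; lra.
  have intDz (x : R) (m : int) : (x + m%:~R \is a Num.int) = (x \is a Num.int).
    by apply: rpredDr; exact: intr_int.
  rewrite /left_floor s1 h1 floorDz intDz.
  by ring.
have sg2 : (-1) ^+ o * (-1) ^+ o = 1 :> int by rewrite -signr_addb addbb.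
transitivity ((-1) ^+ o * \sum_(t \in crossings h 0 1) sg t).
  rewrite ctE mulr_fsumr; apply: eq_fsbigr => t _.
  by rewrite /sg mulrA sg2 mul1r.
by rewrite sumE lf mulrA sg2 mul1r.
Qed.

End Intersection.

(** * A loop of degree one *)

Section NontrivialLoop.
Variables (R : realType) (n : nat) (P : grassmannian R n (2 * n)).
Variables w1 w2 : exterior_form R n (2 * n).
Hypotheses (n_gt0 : (1 <= n)%N)
  (ker_w1 : forall v : 'rV[R]_(2 * n), form_ker w1 v <-> (v <= P)%MS)
  (indep_w : independent_forms w1 w2).

Lemma pencil_form1_neq0 : exists U, w1 U != 0.
Proof.
apply: contrapT => /forallNP w0.
have [|/eqP] := indep_w (a := 1) (b := 0); last by rewrite oner_eq0.
move=> A; rewrite mul0r addr0 mul1r; apply/eqP.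
by have /negP := w0 A; rewrite negbK.
Qed.

(** Otherwise [w2] would vanish as soon as one row lies in P, hence descend to V / P like [w1] and
    be proportional to it. *)
Lemma pencil_form2_row : exists (B : 'M[R]_(n, 2 * n)) i, (row i B <= P)%MS /\ w2 B != 0.
Proof.
apply: contrapT => noB.
have kP v : (v <= P)%MS -> form_ker w2 v.
  move=> vP i A _ Av; apply/eqP/negPn/negP => wA.
  by apply: noB; exists A, i; rewrite Av.
have [U wU] := pencil_form1_neq0.
have fU := wU; rewrite (pencil_form_neq0 n_gt0 ker_w1) in fU.
pose K := cokermx P.
have rK : \rank K = n by rewrite mxrank_coker gr_rank mul2n -addnn addnK.
have KU : (K <= U *m K)%MS.
  by rewrite -(geq_leqif (mxrank_leqif_sup (submxMl U K))) rK (eqP fU).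
have [|_ /eqP] := indep_w (a := w2 U) (b := - w1 U); last by rewrite oppr_eq0 (negPf wU).
move=> A; have /submxP[C AC] := submx_trans (submxMl A K) KU.
have rowP_ i : (row i A - row i (C *m U) <= P)%MS.
  by rewrite -linearB /= submxE -row_mul mulmxBl AC mulmxA subrr row0.
have e1 : w1 A = w1 (C *m U) by apply: form_eq_mod_ker => i; apply/ker_w1.
have e2 : w2 A = w2 (C *m U) by apply: form_eq_mod_ker => i; apply/kP.
by rewrite e1 e2 !form_mulmx; ring.
Qed.

(** As functions of row [j] alone, [w2] on X and [w1] on Y are nonzero linear functionals. One of
    the two given rows, or their sum, is a vector on which neither vanishes. *)
Lemma common_rows (B U : 'M[R]_(n, 2 * n)) (i : 'I_n) (s : seq 'I_n) :
  w2 B != 0 -> w1 U != 0 -> i \notin s ->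
  exists X Y : 'M[R]_(n, 2 * n), [/\ w2 X != 0, w1 Y != 0, row i X = row i B &
    forall j, j \in s -> row j X = row j Y].
Proof.
move=> wB wU; elim: s => [|j s IH]; first by exists B, U.
rewrite inE negb_or => /andP[ij /IH[X [Y [wX wY iX XY]]]].
suff [z [zX zY]] : exists z, w2 (setrow j z X) != 0 /\ w1 (setrow j z Y) != 0.
  exists (setrow j z X), (setrow j z Y); split=> // [|l].
    by rewrite row_setrow (negPf ij).
  by rewrite inE !row_setrow; case: eqP => //= _; exact: XY.
have [Y0|Y0] := eqVneq (w1 (setrow j (row j X) Y)) 0; last first.
  by exists (row j X); rewrite setrow_row.
have [X0|X0] := eqVneq (w2 (setrow j (row j Y) X)) 0; last first.
  by exists (row j Y); rewrite setrow_row.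
exists (row j X + row j Y); rewrite !form_setrowD !setrow_row X0 Y0.
by rewrite addr0 add0r.
Qed.

Lemma pencil_rotation : exists (X : 'M[R]_(n, 2 * n)) i p v y, [/\ y != 0,
  forall a b, w1 (setrow i (a *: p + b *: v) X) = b * y &
  forall a b, w2 (setrow i (a *: p + b *: v) X) = a * y].
Proof.
have [U wU] := pencil_form1_neq0.
have [B [i [iP wB]]] := pencil_form2_row.
have i_s : i \notin [seq j <- enum 'I_n | j != i] by rewrite mem_filter eqxx.
have [X [Y [wX wY iX XY]]] := common_rows wB wU i_s.
pose p := row i X; pose v := row i Y.
have YE : Y = setrow i v X.
  apply/row_matrixP => j; rewrite row_setrow; case: eqVneq => [->//|ji].
  by rewrite XY // mem_filter ji mem_enum.
have w1X : w1 X = 0 by apply: (@form_ker_row _ _ _ _ i); apply/ker_w1; rewrite iX.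
(* The coefficients are solved from the requirement that, with [v'] in row [i], [w1] takes the value
   w2(X) and [w2] vanishes. *)
pose v' := (w2 X / w1 Y) *: v + (- (w2 Y / w1 Y)) *: p.
exists X, i, p, v', (w2 X); split=> // a b;
  rewrite form_setrow_lin [in X in _ + _ * X]form_setrow_lin.
  by rewrite -YE setrow_row w1X; field.
by rewrite -YE setrow_row; field.
Qed.

Let M := pencil_domain w1 w2.
Let phi : continuousType (set_type M) (RP1 R) := @pencil_map R _ _ w1 w2.

Lemma pencil_rotation_loop : exists gamma : loop R (set_type M),
  forall t, phi (gamma t) = rp1_angle (pi / 2 - pi * t).
Proof.
have [X [i [p [v [y [y0 w1E w2E]]]]]] := pencil_rotation.
pose U t := setrow i (cos (pi * t) *: p + sin (pi * t) *: v) X.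
have wU t : w1 (U t) != 0 \/ w2 (U t) != 0.
  rewrite /U w1E w2E !mulf_eq0 (negPf y0) !orbF.
  by case: (cos_sin_neq0 (pi * t)) => h; [right|left].
have fU t : row_free (U t) by case: (wU t) => /form_row_free.
pose W t := Defs.span (fU t).
have UW t : (U t == W t)%MS by exact: span_eqmx.
have MW t : W t \in M by rewrite inE; exists (U t).
pose g t : set_type M := exist _ (W t) (MW t).
have cg : continuous g.
  apply: (@continuous_comp_initial _ _ _ set_val).
  apply: (continuous_gr (U := U)) => //; apply: continuous_setrow; last exact: continuous_const.
  have cpi : continuous (fun t : R => pi * t).
    by apply: continuous_mul; [exact: continuous_const|move=> t; exact: cvg_id].
  apply: continuous_addmx; apply: continuous_scalemx; try exact: continuous_const.
    by move=> t; exact: (continuous_comp (cpi t) (@continuous_cos R _)).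
  by move=> t; exact: (continuous_comp (cpi t) (@continuous_sin R _)).
(* A half turn closes the loop: it only changes the sign of row [i]. *)
have pg t : g (t + 1) = g t.
  apply/val_inj/gr_eqP/eqmxP/(eqmx_trans (eqmx_sym (eqmxP (UW _))))/eqmxP.
  apply: eqmx_span => //; apply/row_subP => j.
  have -> : row j (U (t + 1)) = (if j == i then -1 else 1) *: row j (U t).
    rewrite !row_setrow mulrDr mulr1 cosDpi sinDpi; case: eqP => _; rewrite ?scale1r //.
    by rewrite scalerDr !scalerA !mulN1r.
  by rewrite scalemx_sub // -(eqmxP (UW t)) row_sub.
exists (Loop (loop_fun := mkcts cg : continuousType _ _) pg) => t.
rewrite /phi /= (pencil_mapE (wU t)); last exact: UW.
apply/hpoint_eq; rewrite /U w1E w2E sinB cosB sin_pihalf cos_pihalf; ring.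
Qed.

End NontrivialLoop.

Lemma pairing_pullback (R : realType) (X Y : topologicalType) (f : continuousType X Y)
    (a : H1 R Y) (g : loop R X) :
  pairing (pullback f a) g = pairing a (loop_map f g).
Proof.
rewrite -[a]reprK pullback_pi !pairing_pi /= /pull_cochain; congr (cocycle_val _ _).
exact/continuousEP.
Qed.

Theorem theorem3p4 (R : realType) (n : nat) (n_gt0 : (1 <= n)%N)
  (P : grassmannian R n (2 * n)) (w1 w2 : exterior_form R n (2 * n))
  (indep_w : independent_forms w1 w2)
  (ker_w1 : forall v : 'rV[R]_(2 * n), form_ker w1 v <-> (v <= P)%MS)
  (o : bool) (mu : H1 R (RP1 R)) (mu_gen : orientation_generator o mu) :
  let M := pencil_domain w1 w2 in
  let phi : continuousType (set_type M) (RP1 R) := @pencil_map R _ _ w1 w2 in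
  let alpha : H1 R (set_type M) := pullback phi mu in
  maslov_arnold P alpha /\
  forall gamma : loop R (set_type M),
    winding_number o (loop_map phi gamma) (pairing alpha gamma).
Proof.
move=> M phi alpha.
have alphaE gamma : winding_number o (loop_map phi gamma) (pairing alpha gamma).
  rewrite /alpha pairing_pullback (generator_pairing _ mu_gen).
  exact: winding_number_cochain.
split=> //; split.
  move=> k k0; have [gamma gE] := pencil_rotation_loop n_gt0 ker_w1 indep_w.
  have [theta [ct tE zE]] := alphaE gamma.
  pose th t : R := pi / 2 - pi * t.
  have cth : continuous th.
    apply: (continuous_ext (f := fun t => pi / 2 + (- pi) * t)) => [t|].
      by rewrite mulNr.
    apply: continuous_add; first exact: continuous_const.
    by apply: continuous_mul; [exact: continuous_const|move=> t; exact: cvg_id].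
  (* Comparing the two lifts of phi o gamma shows that the pairing times (-1)^o pi is -pi, so it is
     nonzero and no positive multiple of [alpha] can vanish. *)
  have := lift_unique ct cth (fun t => etrans (esym (tE t)) (gE t)).
  rewrite zE /th mulr1 mulr0 subr0 addrAC subrr add0r => e.
  have z0 : pairing alpha gamma != 0.
    apply/eqP => z0; move: e; rewrite z0 mulr0 => /esym/eqP.
    by rewrite oppr_eq0 gt_eqF ?pi_gt0.
  apply/eqP => ak0; have : pairing (alpha *~ k%:Z) gamma = pairing (alpha *~ 0) gamma.
    by rewrite -pmulrn ak0.
  by rewrite !pairingMz mulr0 => /eqP; rewrite mulf_eq0 (negPf z0) /= eqz_nat gtn_eqF.
exists (positive_side w1 w2 o); first exact: positive_side_coorientation.
move=> gamma gen; have [theta [ct tE zE]] := alphaE gamma.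
exact: (winding_intersection_number n_gt0 ker_w1 ct tE gen zE).
Qed.
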